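(* Consider a Lagrangian control system $$\dot q^i = v^i,\qquad \dot v^i = f^i(q,v,u),\qquad i=1,\dots,p,$$ with $2p$-dimensional classical state $(q,v)$, $m$-dimensional input $u$, and a flat output $y=\varphi(q,v,u,u_{[1]},\ldots)$, and let $R=(r^1,\dots,r^m)$ be the minimal multi-index of its parameterizing map. Then the parameterization of the system variables $(q,v,u)$ by the flat output $y$ is of the form $$q = F_q(y_{[0,R-2]}),\qquad v = F_v(y_{[0,R-1]}),\qquad u = F_u(y_{[0,R]}).$$ For the special case with $m=p-1$ control inputs and a configuration flat output $y^j=\varphi^j(q)$, $j=1,\dots,p-1$, this parameterizing map has the following properties: (i) The multi-index $R=(r^1,\dots,r^{p-1})$ meets $2\le R\le 4$, i.e. $2\le r^j\le 4$ for all $j$. (ii) The parameterization $q=F_q$ depends explicitly on the second-order time derivative $y^j_{[2]}$ of at least one component $y^j$ of the flat output. (iii) The third-order and fourth-order time derivatives of these components of the flat output (those from property (ii)) appear explicitly in the parameterizations $v=F_v$ and $u=F_u$, respectively.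
   Context: Notation. All objects are smooth and all statements are local. Subscripts in square brackets denote time derivatives: $y^j_{[\alpha]}$ is the $\alpha$-th time derivative of $y^j$, and $y_{[\alpha]}=(y^1_{[\alpha]},\dots,y^m_{[\alpha]})$. For a multi-index $A=(a^1,\dots,a^m)$ and an integer $c$, $A\pm c=(a^1\pm c,\dots,a^m\pm c)$, and $A\le c$ (or $A\ge c$) is meant componentwise. Moreover $y_{[0,A]}=(y^1_{[0,a^1]},\dots,y^m_{[0,a^m]})$ with $y^j_{[0,a^j]}=(y^j,y^j_{[1]},\dots,y^j_{[a^j]})$ (empty if $a^j<0$). Lagrangian control system. The configuration space is a $p$-dimensional smooth manifold $\mathcal Q$ with local coordinates $q=(q^1,\dots,q^p)$, and the tangent bundle $\mathcal T(\mathcal Q)$ has coordinates $(q,\dot q)$. The Lagrangian $L(q,\dot q)$ is kinetic minus potential energy, and the external forces enter through a matrix $G(q)$ multiplying the control inputs $u=(u^1,\dots,u^m)$: $$\frac{\mathrm d}{\mathrm dt}\Big(\frac{\partial L}{\partial \dot q^i}\Big)-\frac{\partial L}{\partial q^i}=\sum_{j=1}^m G_{ij}(q)u^j,\qquad i=1,\dots,p.$$ Solving for $\ddot q$ gives the state-space form $\dot q=v$, $\dot v=f(q,v,u)$ with classical state $(q,v)$. Flatness. A system $\dot x=f(x,u)$ with $\dim x=n$, $\dim u=m$ is flat if there is an $m$-tuple of smooth functions $y^j=\varphi^j(x,u,u_{[1]},\ldots)$, $j=1,\dots,m$, depending on finitely many time derivatives of $u$ (defined on a state-input manifold with coordinates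 $(x,u,u_{[1]},\dots,u_{[l_u]})$, $l_u$ large enough), and smooth functions $F_x^i,F_u^j$ such that locally $x^i=F_x^i(y_{[0,R-1]})$, $i=1,\dots,n$, and $u^j=F_u^j(y_{[0,R]})$, $j=1,\dots,m$, for some multi-index $R=(r^1,\dots,r^m)$. Then $y$ is called a flat output and these relations the parameterizing map. The differentials $\mathrm d\varphi,\mathrm d\varphi_{[1]},\dots,\mathrm d\varphi_{[\beta]}$ are linearly independent for every $\beta$, and the parameterizing map is unique with a minimal multi-index $R$, where $r^j$ is the highest order of time derivative of $y^j$ required for expressing $x$ and $u$ in terms of $y$ and its time derivatives. $R$ always denotes this minimal multi-index. Here $x=(q,v)$, $n=2p$, and $F_x=(F_q,F_v)$. Configuration flat output. A flat output depending only on the configuration variables, $y^j=\varphi^j(q)$; it is a smooth submersion from $\mathcal Q$ to a manifold with coordinates $(y^1,\dots,y^{p-1})$. Standing assumption. The flat parameterization is well defined locally around equilibrium points (constant states and inputs $(x_s,u_s)$, parameterized by a constant value $y_s$ of the flat output with all time derivatives of $y$ equal to zero). *)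

(* Defs.v *)
From mathcomp Require Import all_boot all_order all_algebra.
From mathcomp Require Import all_classical all_reals all_analysis.
Set Implicit Arguments.
Unset Strict Implicit.
Unset Printing Implicit Defensive.
Import Order.TTheory GRing.Theory Num.Theory.
Import numFieldNormedType.Exports.
Local Open Scope classical_set_scope.
Local Open Scope ring_scope.

Section Smooth.
Context {R : realType} {V W : normedModType R}.

Fixpoint class_C (O : set V) (k : nat) (f : V -> W) : Prop :=
  if k is k'.+1 then
    (forall x, O x -> differentiable f x) /\ (forall v, class_C O k' ('D_v f))
  else forall x, O x -> {for x, continuous f}.

(* One neighbourhood serves all orders of differentiation. *)
Definition smooth_near (x : V) (f : V -> W) : Prop :=
  exists O, open_nbhs x O /\ forall k, class_C O k f.

End Smooth.

(* Systems xdot = F (x, u) with state space S and m inputs. *)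
Section Jets.
Context {R : realType} {S : normedModType R} {m : nat}.

(* The row vector z.2 a is the a-th time derivative of u. *)
Definition jet : Type := (S * (nat -> 'rV[R]_m))%type.

(* Coordinates (x, u, u_[1], ..., u_[l-1]); only (x) if l = 0. *)
Definition fjet (l : nat) : normedModType R := (S * 'M[R]_(l, m))%type.

Definition trunc (l : nat) (z : jet) : fjet l :=
  (z.1, \matrix_(a < l) z.2 a).

(* "P holds around z0": only finitely many derivatives of u are constrained. *)
Definition near_jet (z0 : jet) (P : jet -> Prop) : Prop :=
  exists L, \forall w \near trunc L z0, forall z, trunc L z = w -> P z.

(* Total time derivative along the system: the derivative of g in the direction
   (F (x, u), u_[1], ..., u_[l]) at (x, u, ..., u_[l-1]). *)
Definition Dt (F : S * 'rV[R]_m -> S) (W : normedModType R) (l : nat)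
    (g : fjet l -> W) : fjet l.+1 -> W :=
  fun z => 'D_(F (z.1, row ord0 z.2), row' ord0 z.2) g (z.1, row' ord_max z.2).

Fixpoint tder (F : S * 'rV[R]_m -> S) (W : normedModType R) (l k : nat)
    (g : fjet l -> W) : fjet (k + l) -> W :=
  match k return fjet (k + l) -> W with
  | 0 => g
  | k'.+1 => Dt F (@tder F W l k' g)
  end.

Arguments tder F {W l} k g.

(* Row k is phi_[k]. *)
Definition yjet (F : S * 'rV[R]_m -> S) (l : nat) (phi : fjet l -> 'rV[R]_m)
    (N : nat) (z : jet) : 'M[R]_(N, m) :=
  \matrix_(k < N) tder F k phi (trunc (k + l) z).

Definition equilibrium (F : S * 'rV[R]_m -> S) (xs : S) (us : 'rV[R]_m) : Prop :=
  F (xs, us) = 0.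

Definition const_jet (xs : S) (us : 'rV[R]_m) : jet :=
  (xs, fun a => if a is 0 then us else 0).

End Jets.
Arguments jet {R} S m.
Arguments fjet {R} S m l.

Section Flatness.
Context {R : realType} {S : normedModType R} {m : nat}.

(* Number of rows of a matrix (k, j) |-> y^j_[k] with room for y_[0,r]. *)
Definition nrows (r : 'I_m -> nat) : nat := (\max_(j < m) r j).+1.

(* H is a function of y_[0,r-c]: it factors through the coordinates y^j_[k] with
   k <= r^j - c (no coordinate of y^j if r^j < c). *)
Definition function_of (r : 'I_m -> nat) (c N : nat) (W : Type)
    (H : 'M[R]_(N, m) -> W) : Prop :=
  forall Y Y' : 'M[R]_(N, m),
    (forall (k : 'I_N) (j : 'I_m), (k + c <= r j)%N -> Y k j = Y' k j) ->
    H Y = H Y'.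

Definition y_dir (N k : nat) (j : 'I_m) : 'M[R]_(N, m) :=
  \matrix_(a, b) ((a == k :> nat) && (b == j))%:R.

(* The partial derivative of H by y^j_[k] does not vanish identically on any
   neighbourhood of Y0.  A k >= N would give the zero direction, hence False. *)
Definition depends_explicitly (N : nat) (W : normedModType R)
    (H : 'M[R]_(N, m) -> W) (Y0 : 'M[R]_(N, m)) (j : 'I_m) (k : nat) : Prop :=
  ~ (\forall Y \near Y0, 'D_(y_dir N k j) H Y = 0).

(* x = Fx (y_[0,r-1]), u = Fu (y_[0,r]) locally around z0.  Fx and Fu are total;
   their values outside a neighbourhood of (the jet of y at) z0 are irrelevant. *)
Definition parameterizes (F : S * 'rV[R]_m -> S) (l : nat)
    (phi : fjet S m l -> 'rV[R]_m) (z0 : jet S m) (r : 'I_m -> nat)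
    (Fx : 'M[R]_(nrows r, m) -> S) (Fu : 'M[R]_(nrows r, m) -> 'rV[R]_m) : Prop :=
  let Y := yjet F phi (nrows r) in
  [/\ function_of r 1 Fx, smooth_near (Y z0) Fx,
      function_of r 0 Fu, smooth_near (Y z0) Fu &
      near_jet z0 (fun z => z.1 = Fx (Y z) /\ z.2 0%N = Fu (Y z))].

Definition admissible (F : S * 'rV[R]_m -> S) (l : nat)
    (phi : fjet S m l -> 'rV[R]_m) (z0 : jet S m) (r : 'I_m -> nat) : Prop :=
  exists Fx Fu, parameterizes F phi z0 (r := r) Fx Fu.

Definition flat_output (F : S * 'rV[R]_m -> S) (l : nat)
    (phi : fjet S m l -> 'rV[R]_m) (z0 : jet S m) : Prop :=
  smooth_near (trunc l z0) phi /\ exists r, admissible F phi z0 r.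

Definition minimal_multi_index (F : S * 'rV[R]_m -> S) (l : nat)
    (phi : fjet S m l -> 'rV[R]_m) (z0 : jet S m) (r : 'I_m -> nat) : Prop :=
  admissible F phi z0 r /\
  forall r', admissible F phi z0 r' -> forall j, (r j <= r' j)%N.

End Flatness.

Section Lagrangian.
Context {R : realType} {p m : nat}.
Local Notation config := 'rV[R]_p.
Local Notation state := ('rV[R]_p * 'rV[R]_p)%type.
Local Notation input := 'rV[R]_m.

(* Kinetic minus potential energy, with mass matrix M. *)
Definition lagrangian (M : config -> 'M[R]_p) (V : config -> R) (x : state) : R :=
  (x.2 *m M x.1 *m x.2^T) 0 0 / 2 - V x.1.

(* The system qdot = v, vdot = f (q, v, u). *)
Definition sode (f : state * input -> config) (w : state * input) : state :=
  (w.1.2, f w).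

(* d/dt (dL/dqdot^i) - dL/dq^i = sum_j G_ij u^j at w = (q, v, u), the time
   derivative being taken along the system. *)
Definition euler_lagrange (L : state -> R) (G : config -> 'M[R]_(p, m))
    (f : state * input -> config) (w : state * input) : Prop :=
  forall i : 'I_p,
    'D_(sode f w) ('D_(0 : config, delta_mx 0 i : config) L) w.1
      - 'D_(delta_mx 0 i : config, 0 : config) L w.1
    = \sum_(j < m) G w.1.1 i j * w.2 0 j.

(* Everything is required locally around (xs, us) only.  Of the mass matrix only
   symmetry and invertibility (solvability for the accelerations) are required, so
   positive definite ones are included. *)
Definition lagrangian_control_system (M : config -> 'M[R]_p) (V : config -> R)
    (G : config -> 'M[R]_(p, m)) (f : state * input -> config)
    (xs : state) (us : input) : Prop :=
  [/\ [/\ smooth_near xs.1 M, smooth_near xs.1 V & smooth_near xs.1 G],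
      \forall q \near xs.1, (M q)^T = M q /\ M q \in unitmx,
      smooth_near (xs, us) f &
      \forall w \near (xs, us), euler_lagrange (lagrangian M V) G f w].

(* phi depends on q only, through a smooth submersion h. *)
Definition configuration_output (l : nat) (phi : fjet state m l -> input)
    (z0 : jet state m) : Prop :=
  exists h : config -> input,
    [/\ smooth_near z0.1.1 h,
        \forall q \near z0.1.1, forall e, exists d, 'd h q d = e &
        \forall z \near trunc l z0, phi z = h z.1.1].

End Lagrangian.

(* Main.v *)
(* At the equilibrium the differentials of the output derivatives y_[k] are obtained
   from that of y by a fixed linear shift.  As the input perturbations are arbitrary
   and equal P(d/dt) dy for a square polynomial matrix P, a linear relation among the
   dy_[k] would make P singular; so they are independent, the jet of the output is an
   open map, and identities along the system become identities between functions of
   free jet coordinates: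
     d/dt Fq = Fv,   d/dt Fv = f (Fq, Fv, Fu),   h (Fq) = y.
   If the highest derivative of y^j in a function H has order k, then y^j_[k+1] enters
   d/dt H linearly, with the same coefficient.  Applied to Fq and Fv this gives the
   orders in the parameterization and (iii).

   For p = m + 1 the essential point is that Fq contains no derivative of order
   k >= 3.  Otherwise let T = dFq/dy^j_[k] <> 0 with k maximal, so T spans ker dh.
   For each i, subtracting multiples of the directions y^j_[k] and y^j_[k+1] from the
   direction y^i_[2] yields a direction X_i along which q and v are stationary and
   dh (X_i vdot) = e_i.  The m + 1 independent vectors T = dvdot/dy^j_[k+2] and
   X_i vdot then all lie in the image of df/du, whose rank is at most m. *)
Require Import Defs.
From HB Require Import structures.
From mathcomp Require Import all_boot all_order all_algebra.
From mathcomp Require Import all_classical all_reals all_analysis.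
From mathcomp Require Import ring lra zify.
Import Order.TTheory GRing.Theory Num.Theory.
Import numFieldNormedType.Exports.
Local Open Scope classical_set_scope.
Local Open Scope ring_scope.
Set Implicit Arguments.
Unset Strict Implicit.
Unset Printing Implicit Defensive.

(** * Linear maps and finite coordinates *)

Section LinearMaps.
Context {R : realType}.
Implicit Types U V W : normedModType R.

(** Explicit dependence on a coordinate means that the partial derivative is nonzero arbitrarily
    close to the equilibrium, possibly not at it. A vector T as in the overview may thus be zero at
    the equilibrium, and the dimension count has to run at every nearby jet; this is why all
    identities are carried on a neighbourhood. The independence of the dy_[k], in contrast, is
    needed at the equilibrium alone, where the linearised dynamics have constant coefficients and
    polynomial matrices suffice; openness of the output jet map carries its effect to a
    neighbourhood. For u this requires df/du to be injective near the equilibrium, which is itself a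
    consequence of flatness: an input perturbation in the kernel would be invisible in all
    dy_[k]. *)

Definition lincont V W (L : V -> W) := linear L /\ continuous L.

Lemma lincont_pack V W (L : V -> W) : lincont L ->
  exists L' : {linear V -> W}, continuous L' /\ L = L'.
Proof.
move=> [lL cL]; pose LM := GRing.isLinear.Build _ _ _ _ _ lL.
by exists (HB.pack L LM : {linear _ -> _}).
Qed.

Lemma lincont_diff V W (L : V -> W) x : lincont L -> differentiable L x.
Proof. by move=> /lincont_pack [L' [cL ->]]; exact: linear_differentiable. Qed.

Lemma lincont_derive V W (L : V -> W) x v : lincont L -> 'D_v L x = L v.
Proof.
move=> lL; rewrite deriveE; last exact: lincont_diff.
by have [L' [cL ->]] := lincont_pack lL; rewrite diff_lin.
Qed.

Lemma lincontD V W (L : V -> W) u v : lincont L -> L (u + v) = L u + L v.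
Proof. by move=> /lincont_pack[L' [_ ->]]; rewrite linearD. Qed.

Lemma lincontB V W (L : V -> W) u v : lincont L -> L (u - v) = L u - L v.
Proof. by move=> /lincont_pack[L' [_ ->]]; rewrite linearB. Qed.

Lemma lincontZ V W (L : V -> W) (a : R) u : lincont L -> L (a *: u) = a *: L u.
Proof. by move=> /lincont_pack[L' [_ ->]]; rewrite linearZ. Qed.

Lemma lincont0 V W (L : V -> W) : lincont L -> L 0 = 0.
Proof. by move=> /lincont_pack[L' [_ ->]]; rewrite linear0. Qed.

Lemma lincont_sum V W (L : V -> W) (I : finType) (F : I -> V) :
  lincont L -> L (\sum_i F i) = \sum_i L (F i).
Proof. by move=> /lincont_pack[L' [_ ->]]; rewrite linear_sum. Qed.

Lemma lincont_id V : lincont (@id V).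
Proof. by split => // x; exact: cvg_id. Qed.

Lemma lincont_comp U V W (K : U -> V) (L : V -> W) :
  lincont K -> lincont L -> lincont (L \o K).
Proof.
move=> lK lL; split=> [a u v|x]; first by rewrite /= lK.1 lL.1.
by apply: continuous_comp; [exact: lK.2|exact: lL.2].
Qed.

Lemma lincont_pair U V W (K : U -> V) (L : U -> W) :
  lincont K -> lincont L -> lincont (fun x => (K x, L x)).
Proof.
move=> lK lL; split=> [a u v|x]; first by rewrite lK.1 lL.1.
by apply: cvg_pair; [exact: lK.2|exact: lL.2].
Qed.

Lemma lincont_fst V W : lincont (@fst V W).
Proof. by split=> [a [? ?] [? ?]|x] //; exact: cvg_fst. Qed.

Lemma lincont_snd V W : lincont (@snd V W).
Proof. by split=> [a [? ?] [? ?]|x] //; exact: cvg_snd. Qed.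

Lemma lincont_add V : lincont (fun z : V * V => z.1 + z.2).
Proof.
split=> [a [? ?] [? ?]|x]; first by rewrite /= scalerDr addrACA.
exact: add_continuous.
Qed.

Lemma lincont_derive_dir V W (f : V -> W) x :
  differentiable f x -> lincont (fun v => 'D_v f x).
Proof.
move=> df; have -> : (fun v => 'D_v f x) = 'd f x.
  by apply/funext => v; rewrite deriveE.
by split; [exact: linearP|exact: diff_continuous].
Qed.

(** Finite dimension without a basis: the generators [e] need not be independent. This is enough to
    make linear maps continuous and to recover a derivative from finitely many directional ones, and
    it passes to products. *)
Definition fincoord V :=
  exists (I : finType) (e : I -> V) (c : I -> V -> R),
    (forall i, lincont (c i)) /\ forall v, v = \sum_i c i v *: e i.

Lemma lin_pack V W (L : V -> W) : linear L ->
  exists L' : {linear V -> W}, L = L'.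
Proof.
by move=> lL; pose LM := GRing.isLinear.Build _ _ _ _ _ lL;
   exists (HB.pack L LM : {linear _ -> _}).
Qed.

Lemma fincoord_lincont V W (L : V -> W) : fincoord V -> linear L -> lincont L.
Proof.
move=> [I [e [c [lc ve]]]] lL; split=> //.
have LE : L = fun v => \sum_i c i v *: L (e i).
  have [L' ->] := lin_pack lL.
  apply/funext => v; rewrite [in LHS](ve v) linear_sum.
  by apply: eq_bigr => i _; rewrite linearZ.
rewrite LE; apply: continuous_big => [|i _ x]; first exact: add_continuous.
by apply: cvgZr_tmp; exact: (lc i).2.
Qed.

Lemma fincoord_prod V W : fincoord V -> fincoord W -> fincoord (V * W)%type.
Proof.
move=> [I [e [c [lc ve]]]] [J [e' [c' [lc' ve']]]].
exists (I + J)%type.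
exists (fun i => match i with inl i => (e i, 0) | inr j => (0, e' j) end).
exists (fun i v => match i with inl i => c i v.1 | inr j => c' j v.2 end).
split=> [[i|j]|[v w]].
- exact: (lincont_comp (lincont_fst V W) (lc i)).
- exact: (lincont_comp (lincont_snd V W) (lc' j)).
- rewrite big_sumType /= [in LHS](ve v) [in LHS](ve' w).
  rewrite (eq_bigr (fun i => (c i v *: e i, 0 : W))); last first.
    by move=> i _; congr pair; rewrite /= scaler0.
  rewrite [X in _ + X](eq_bigr (fun i => (0 : V, c' i w *: e' i))); last first.
    by move=> i _; congr pair; rewrite /= scaler0.
  pose inL (x : V) := (x, 0 : W); pose inR (x : W) := (0 : V, x).
  have lL : linear inL by move=> a x y; congr pair; rewrite /= scaler0 addr0.
  have lR : linear inR by move=> a x y; congr pair; rewrite /= scaler0 addr0.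
  have [L' EL] := lin_pack lL; have [R' ER] := lin_pack lR.
  have -> : \sum_i (c i v *: e i, 0 : W) = inL (\sum_i (c i v *: e i)).
    by rewrite EL linear_sum -EL.
  have -> : \sum_i (0 : V, c' i w *: e' i) = inR (\sum_i (c' i w *: e' i)).
    by rewrite ER linear_sum -ER.
  by congr pair; rewrite /= ?addr0 ?add0r.
Qed.

Lemma fincoord_mx m n : fincoord 'M[R]_(m, n).
Proof.
exists ('I_m * 'I_n)%type, (fun i => delta_mx i.1 i.2).
exists (fun i (A : 'M[R]_(m, n)) => A i.1 i.2); split=> [i|A].
  split=> [a u v|x]; first by rewrite !mxE.
  exact: coord_continuous.
by rewrite {1}(matrix_sum_delta A) pair_bigA.
Qed.

Lemma lincont_coord m n i j : lincont (fun A : 'M[R]_(m, n) => A i j).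
Proof. by apply: fincoord_lincont; [exact: fincoord_mx|move=> a u v; rewrite !mxE]. Qed.
End LinearMaps.

(** * Differentiability classes through tangent maps *)

Section TangentMap.
Context {R : realType}.
Implicit Types U V W : normedModType R.

Definition tgt V W (f : V -> W) (z : V * V) : W := 'D_(z.2) f z.1.

Definition cyl V (O : set V) : set (V * V) := [set z | O z.1].

(* Unlike the directional derivatives of [class_C], the tangent map turns the chain
   rule into a composition, so that [ck] is stable under composition by induction. *)
Fixpoint ck (k : nat) {V W : normedModType R} (O : set V) (f : V -> W)
    {struct k} : Prop :=
  match k with
  | 0 => forall x, O x -> {for x, continuous f}
  | k'.+1 => (forall x, O x -> differentiable f x) /\ ck k' (cyl O) (tgt f)
  end.

Lemma cyl_open V (O : set V) : open O -> open (cyl O).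
Proof. by move=> oO; apply: open_comp => // x _; exact: (lincont_fst V V).2. Qed.

Lemma ck_subset k V W (O O' : set V) (f : V -> W) :
  O `<=` O' -> ck k O' f -> ck k O f.
Proof.
elim: k V W O O' f => [|k IH] V W O O' f /= OO'; first by move=> h x /OO'/h.
move=> [df cf]; split=> [x /OO'/df //|].
by apply: IH cf => z /OO'.
Qed.

Lemma open_near V (O : set V) x (P : V -> Prop) : open O -> O x ->
  (forall y, O y -> P y) -> \forall y \near x, P y.
Proof. by move=> oO Ox OP; apply: filterS (open_nbhs_nbhs (conj oO Ox)). Qed.

Lemma eq_derive_on V W (O : set V) (f g : V -> W) x v : open O -> O x ->
  (forall y, O y -> f y = g y) -> 'D_v f x = 'D_v g x.
Proof. by move=> oO Ox fg; apply: near_eq_derive; exact: open_near fg. Qed.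

Lemma near_eq_diff V W (f g : V -> W) x : (\forall y \near x, f y = g y) ->
  differentiable f x -> differentiable g x.
Proof.
move=> fg df; have [dc dfE] := (diff_locallyP x f).1 df.
have dgE : g \o shift x = cst (g x) + 'd f x +o_ 0 id.
  apply/eqaddoP => e e0; have /eqaddoP/(_ _ e0) := dfE.
  have fg0 : \forall h \near 0, f (h + x) = g (h + x).
    move: fg; rewrite (near_shift 0)/=; apply: filterS => h.
    by rewrite subr0.
  apply: filterS2 fg0 => h fgh.
  rewrite /= !fctE /= fgh.
  by rewrite /cst (nbhs_singleton fg).
by apply/diff_locallyP; rewrite (diff_unique dc dgE).
Qed.

Lemma ck_eq k V W (O : set V) (f g : V -> W) : open O ->
  (forall y, O y -> f y = g y) -> ck k O f -> ck k O g.
Proof.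
elim: k V W O f g => [|k IH] V W O f g oO fg /=.
  move=> cf x Ox; rewrite /prop_for /continuous_at -(fg _ Ox).
  apply: cvg_trans (cf x Ox); apply: near_eq_cvg; exact: open_near fg.
move=> [df cf]; split=> [x Ox|].
  by apply: near_eq_diff (df x Ox); exact: open_near fg.
by apply: IH cf => [|z Oz]; [exact: cyl_open|exact: eq_derive_on fg].
Qed.

Lemma ckW k V W (O : set V) (f : V -> W) : ck k.+1 O f -> ck k O f.
Proof.
elim: k V W O f => [|k IH] V W O f; last by move=> [df cf]; split=> //; exact: IH.
by move=> [df _] x /df; exact: differentiable_continuous.
Qed.

Lemma ck_cst k V W (O : set V) (w : W) : ck k O (fun _ : V => w).
Proof.
elim: k V O w => [|k IH] V O w /=; first by move=> x _; exact: cvg_cst.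
split=> [x _|]; first exact: differentiable_cst.
have -> : tgt (fun _ : V => w) = fun _ => 0 by apply/funext => z; exact: derive_cst.
exact: IH.
Qed.

Lemma ck_lin k V W (O : set V) (L : V -> W) : lincont L -> ck k O L.
Proof.
elim: k V W O L => [|k IH] V W O L lL /=; first by move=> x _; exact: lL.2.
split=> [x _|]; first exact: lincont_diff.
have -> : tgt L = L \o snd by apply/funext => z; exact: lincont_derive.
by apply: IH; apply: lincont_comp lL; exact: lincont_snd.
Qed.

Lemma derive_pair V W W' (f : V -> W) (g : V -> W') x v :
  differentiable f x -> differentiable g x ->
  'D_v (fun x => (f x, g x)) x = ('D_v f x, 'D_v g x).
Proof.
move=> df dg; rewrite !deriveE //; last exact: differentiable_pair.
by rewrite diff_pair.
Qed.

Lemma ck_pair k V W W' (O : set V) (f : V -> W) (g : V -> W') : open O ->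
  ck k O f -> ck k O g -> ck k O (fun x => (f x, g x)).
Proof.
elim: k V W W' O f g => [|k IH] V W W' O f g oO /=.
  by move=> cf cg x Ox; apply: cvg_pair; [exact: cf|exact: cg].
move=> [df cf] [dg cg]; split=> [x Ox|].
  by apply: differentiable_pair; [exact: df|exact: dg].
apply: ck_eq (IH _ _ _ _ _ _ (cyl_open oO) cf cg); first exact: cyl_open.
by move=> z Oz; rewrite [RHS]derive_pair //; [exact: df|exact: dg].
Qed.

Lemma derive_comp U V W (g : U -> V) (f : V -> W) x v :
  differentiable g x -> differentiable f (g x) ->
  'D_v (f \o g) x = 'D_('D_v g x) f (g x).
Proof.
move=> dg df; rewrite !deriveE //; last exact: differentiable_comp.
by rewrite diff_comp.
Qed.

Lemma ck_comp k U V W (O : set U) (O' : set V) (g : U -> V) (f : V -> W) :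
  open O -> open O' -> (forall x, O x -> O' (g x)) ->
  ck k O g -> ck k O' f -> ck k O (f \o g).
Proof.
elim: k U V W O O' g f => [|k IH] U V W O O' g f oO oO' gO.
  by move=> cg cf x Ox; apply: continuous_comp; [exact: cg|exact/cf/gO].
move=> cg [df cf]; have [dg cg'] := cg.
split=> [x Ox|]; first by apply: differentiable_comp; [exact: dg|exact/df/gO].
have cO := cyl_open oO.
have h : ck k (cyl O) (fun z => (g z.1, tgt g z)).
  apply: ck_pair => //; have : ck k (cyl O) (g \o fst); last by [].
  apply: (IH _ _ _ _ O) => //; last exact: ckW.
  exact/ck_lin/lincont_fst.
apply: ck_eq (IH _ _ _ _ (cyl O') _ _ cO _ _ h cf) => //.
- by move=> z Oz; rewrite [RHS]derive_comp //; [exact: dg|exact/df/gO].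
- exact: cyl_open.
- by move=> z Oz; exact: gO.
Qed.

Lemma ck_lin_comp k V W W' (O : set V) (f : V -> W) (L : W -> W') : open O ->
  lincont L -> ck k O f -> ck k O (L \o f).
Proof.
move=> oO lL cf; apply: (@ck_comp _ _ _ _ O setT) => //; first exact: openT.
exact: ck_lin.
Qed.

Lemma ckD k V W (O : set V) (f g : V -> W) : open O ->
  ck k O f -> ck k O g -> ck k O (fun x => f x + g x).
Proof.
move=> oO cf cg.
exact: (ck_lin_comp oO (lincont_add W) (ck_pair oO cf cg)).
Qed.

Lemma ck_sum k V W (O : set V) (I : finType) (f : I -> V -> W) : open O ->
  (forall i, ck k O (f i)) -> ck k O (fun x => \sum_i f i x).
Proof.
move=> oO cf; elim: (index_enum I) => [|i s IH].
  by apply: ck_eq (ck_cst k O 0) => // y _; rewrite big_nil.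
by apply: ck_eq (ckD oO (cf i) IH) => // y _; rewrite big_cons.
Qed.

Lemma scale_is_bilinear V :
  bilinear_for
    (GRing.Scale.Law.clone _ _ *:%R _) (GRing.Scale.Law.clone _ _ *:%R _)
    (@GRing.scale R V : R -> V -> V).
Proof.
split=> [v a x y|u a x y] /=; first by rewrite scalerDl scalerA.
by rewrite scalerDr !scalerA mulrC.
Qed.

Lemma scale_diff V (z d : R * V) :
  differentiable (fun z : R * V => z.1 *: z.2) z /\
  'D_d (fun z : R * V => z.1 *: z.2) z = z.1 *: d.2 + d.1 *: z.2.
Proof.
pose sM := bilinear_isBilinear.Build R R V V _ _ _ (@scale_is_bilinear V).
pose s := HB.pack (@GRing.scale R V : R -> V -> V) sM : {bilinear R -> V -> V}.
have sc : continuous (fun p : R * V => s p.1 p.2).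
  by move=> x; apply: scale_continuous.
by split; [exact: (differentiable_bilin z sc)|rewrite deriveE ?(diff_bilin z sc)//;
  exact: (differentiable_bilin z sc)].
Qed.

(** The tangent map of the product is a sum of two products of linear projections, so the induction
    reproduces itself; [ckZ] then follows by composition. *)
Lemma ck_scale k V (O : set (R * V)%type) :
  open O -> ck k O (fun z : R * V => z.1 *: z.2).
Proof.
elim: k V O => [|k IH] V O oO /=; first by move=> x _; apply: scale_continuous.
split=> [x _|]; first exact: (scale_diff x 0).1.
have -> : tgt (fun z : R * V => z.1 *: z.2) =
    fun z : (R * V) * (R * V) => z.1.1 *: z.2.2 + z.2.1 *: z.1.2.
  by apply/funext => z; exact: (scale_diff _ _).2.
have l11 : lincont (fun z : (R * V) * (R * V) => z.1.1).
  exact: (lincont_comp (lincont_fst _ _) (lincont_fst _ _)).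
have l12 : lincont (fun z : (R * V) * (R * V) => z.1.2).
  exact: (lincont_comp (lincont_fst _ _) (lincont_snd _ _)).
have l21 : lincont (fun z : (R * V) * (R * V) => z.2.1).
  exact: (lincont_comp (lincont_snd _ _) (lincont_fst _ _)).
have l22 : lincont (fun z : (R * V) * (R * V) => z.2.2).
  exact: (lincont_comp (lincont_snd _ _) (lincont_snd _ _)).
have cO := cyl_open oO.
have c1 (K : (R * V) * (R * V) -> R) (L : (R * V) * (R * V) -> V) :
    lincont K -> lincont L -> ck k (cyl O) (fun z => K z *: L z).
  move=> lK lL; have : ck k (cyl O) ((fun z : R * V => z.1 *: z.2) \o
    (fun x => (K x, L x))); last by [].
  apply: (@ck_comp _ _ _ _ _ setT) => //; [exact: openT|..|exact/IH/openT].
  by apply: ck_lin; exact: lincont_pair.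
by apply: ckD => //; exact: c1.
Qed.

Lemma ckZ k V W (O : set V) (c : V -> R) (f : V -> W) : open O ->
  ck k O c -> ck k O f -> ck k O (fun x => c x *: f x).
Proof.
move=> oO cc cf.
have : ck k O ((fun z : R * W => z.1 *: z.2) \o (fun x => (c x, f x))); last by [].
by apply: (@ck_comp _ _ _ _ _ setT) => //;
  [exact: openT|exact: ck_pair|exact/ck_scale/openT].
Qed.

Lemma ck_class_C k V W (O : set V) (f : V -> W) :
  open O -> ck k O f -> class_C O k f.
Proof.
elim: k f => [|k IH] f oO //= [df cf]; split=> // v; apply: IH => //.
have : ck k O ((tgt f) \o (fun x => (x, v))); last by [].
apply: (@ck_comp _ _ _ _ O (cyl O)) => //; first exact: cyl_open.
by apply: ck_pair; [|exact/ck_lin/lincont_id|exact: ck_cst].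
Qed.

(** [class_C] fixes the direction v, whereas [ck] asks for joint regularity in (x, v). Finite
    coordinates bridge the two: the tangent map is the sum of the [c i v *: 'D_(e i) f x]. *)
Lemma class_C_ck k V W (O : set V) (f : V -> W) : fincoord V ->
  open O -> class_C O k f -> ck k O f.
Proof.
move=> fV; have [I [e [c [lc ve]]]] := fV.
elim: k f => [|k IH] f oO //= [df cf]; split=> //.
have cO := cyl_open oO.
suff h : ck k (cyl O) (fun z => \sum_i c i z.2 *: 'D_(e i) f z.1).
  apply: ck_eq h => // -[x v] /= Ox; rewrite /tgt /= [in RHS](ve v).
  have lD := lincont_derive_dir (df _ Ox).
  rewrite (lincont_sum _ lD); apply: eq_bigr => i _; exact/esym/(lincontZ _ _ lD).
apply: ck_sum => // i; apply: ckZ => //.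
  exact/ck_lin/(lincont_comp (lincont_snd _ _) (lc i)).
have : ck k (cyl O) ('D_(e i) f \o fst); last by [].
apply: (@ck_comp _ _ _ _ _ O) => //; first exact/ck_lin/lincont_fst.
exact: IH.
Qed.

End TangentMap.

(** * Germs of smooth functions *)

Section Germs.
Context {R : realType}.
Implicit Types U V W : normedModType R.

Definition smooth_at V W (x : V) (f : V -> W) :=
  exists O, open_nbhs x O /\ forall k, ck k O f.

Lemma smooth_nearE V W (x : V) (f : V -> W) : fincoord V ->
  smooth_near x f <-> smooth_at x f.
Proof.
move=> fV; split; case=> O [ [oO Ox] h]; exists O; split=> // k.
  exact: class_C_ck (h k).
exact: ck_class_C (h k).
Qed.

Lemma smooth_at_near V W (x : V) (f : V -> W) :
  smooth_at x f -> \forall y \near x, smooth_at y f.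
Proof. by move=> [ O [ [oO Ox] h]]; apply: (open_near oO Ox) => y Oy; exists O. Qed.

Lemma smooth_at_diff V W (x : V) (f : V -> W) :
  smooth_at x f -> differentiable f x.
Proof. by move=> [ O [ [oO Ox] h]]; exact: (h 1%N).1. Qed.

Lemma smooth_at_cont V W (x : V) (f : V -> W) :
  smooth_at x f -> {for x, continuous f}.
Proof. by move=> /smooth_at_diff; exact: differentiable_continuous. Qed.

Lemma smooth_at_lin V W (x : V) (L : V -> W) : lincont L -> smooth_at x L.
Proof.
by move=> lL; exists setT; split=> [|k]; [split=> //; exact: openT|exact: ck_lin].
Qed.

Lemma smooth_at_cst V W (x : V) (w : W) : smooth_at x (fun _ => w).
Proof.
by exists setT; split=> [|k]; [split=> //; exact: openT|exact: ck_cst].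
Qed.

Lemma smooth_at_pair V W W' (x : V) (f : V -> W) (g : V -> W') :
  smooth_at x f -> smooth_at x g -> smooth_at x (fun y => (f y, g y)).
Proof.
move=> [ O [ [oO Ox] h]] [ O' [ [oO' Ox'] h']]; have oI := openI oO oO'.
exists (O `&` O'); split=> // k.
apply: ck_pair => //.
  by apply: ck_subset (h k) => z [].
by apply: ck_subset (h' k) => z [].
Qed.

Lemma smooth_at_comp U V W (x : U) (g : U -> V) (f : V -> W) :
  smooth_at x g -> smooth_at (g x) f -> smooth_at x (f \o g).
Proof.
move=> [ O [ [oO Ox] h]] [ O' [ [oO' Ox'] h']].
have oO2 : open (O `&` g @^-1` O').
  rewrite openE => y [Oy Oy']; apply: filterI; first exact: open_nbhs_nbhs.
  by apply: (h 0%N _ Oy); exact: open_nbhs_nbhs.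
exists (O `&` g @^-1` O'); split=> // k.
apply: (@ck_comp _ _ _ _ _ _ O') => //; first by move=> y [].
by apply: ck_subset (h k) => y [].
Qed.

Lemma smooth_at_tgt V W (x v : V) (f : V -> W) :
  smooth_at x f -> smooth_at (x, v) (tgt f).
Proof.
move=> [ O [ [oO Ox] h]]; exists (cyl O); split=> [|k]; last exact: (h k.+1).2.
by split=> //; exact: cyl_open.
Qed.

Lemma smooth_at_derive V W (x v : V) (f : V -> W) :
  smooth_at x f -> smooth_at x ('D_v f).
Proof.
move=> sf; have : smooth_at x (tgt f \o (fun y => (y, v))); last by [].
apply: smooth_at_comp; last exact: smooth_at_tgt.
by apply: smooth_at_pair; [exact/smooth_at_lin/lincont_id|exact: smooth_at_cst].
Qed.

Lemma smooth_at_eq V W (x : V) (f g : V -> W) :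
  (\forall y \near x, f y = g y) -> smooth_at x f -> smooth_at x g.
Proof.
move=> fg [ O [ [oO Ox] h]]; pose A := O `&` [set y | f y = g y].
have nA : nbhs x A by apply: filterI => //; exact: open_nbhs_nbhs (conj oO Ox).
exists (A°); split=> [|k]; first by split; [exact: open_interior|].
apply: (@ck_eq _ _ _ _ _ f g) => //; first exact: open_interior.
  by move=> y /interior_subset [].
by apply: ck_subset (h k) => y /interior_subset [].
Qed.

Lemma near_derive V W (x : V) (f g : V -> W) :
  (\forall y \near x, f y = g y) -> \forall y \near x, forall v, 'D_v f y = 'D_v g y.
Proof.
by move=> /near_join; apply: filterS => y fg v; exact: near_eq_derive.
Qed.

Lemma derive_linl U V W (L : U -> V) (f : V -> W) x v : lincont L ->
  'D_v (f \o L) x = 'D_(L v) f (L x).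
Proof.
move=> lL; rewrite /derive.
set F := (X in lim (X @ _)); set G := (X in _ = lim (X @ _)).
suff -> : F = G by [].
by apply/funext => h; rewrite /F /G /= (lincontD _ _ lL) (lincontZ _ _ lL).
Qed.

Lemma derive_linr V W W' (L : W -> W') (f : V -> W) x v : lincont L ->
  differentiable f x -> 'D_v (L \o f) x = L ('D_v f x).
Proof.
by move=> lL df; rewrite (derive_comp _ df (lincont_diff _ lL)) lincont_derive.
Qed.

Lemma derive_affine V (a d : V) (t : R) :
  differentiable (fun t : R => a + t *: d) t /\ 'D_1 (fun t : R => a + t *: d) t = d.
Proof.
have ls : lincont (fun t : R => t *: d).
  split=> [b s r|s]; first by rewrite scalerDl scalerA.
  exact: scalel_continuous.
have ds := lincont_diff t ls.
have E : (fun t : R => a + t *: d) = cst a + (fun t : R => t *: d) by [].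
rewrite E; split.
  by apply: differentiableD => //; exact: differentiable_cst.
rewrite deriveD; [|exact/diff_derivable/differentiable_cst|exact: diff_derivable].
by rewrite derive_cst add0r lincont_derive// scale1r.
Qed.

Lemma mx_norm_le m n (A : 'M[R]_(m, n)) (c : R) : 0 <= c ->
  (forall i j, `|A i j| <= c) -> `|A| <= c.
Proof.
move=> c0 h; rewrite [leLHS]/Num.Def.normr/= mx_normrE.
by apply: bigmax_le => // -[i j] _; exact: h.
Qed.

Lemma mx_norm_coord m n (A : 'M[R]_(m, n)) i j : `|A i j| <= `|A|.
Proof.
rewrite [leRHS]/Num.Def.normr/= mx_normrE.
exact: (le_bigmax _ (fun ij => `|A ij.1 ij.2|) (i, j)).
Qed.

(** The norm of a matrix is the largest modulus of its entries, so the scalar mean value theorem may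
    be applied to each entry along the segment. *)
Lemma mean_value_mx V m n (f : V -> 'M[R]_(m, n)) (a b : V) (c : R) :
  (forall t : R, 0 <= t <= 1 -> differentiable f (a + t *: (b - a)) /\
     `|'D_(b - a) f (a + t *: (b - a))| <= c) ->
  `|f b - f a| <= c.
Proof.
move=> h; have c0 : 0 <= c.
  by have [|_] := h 0; rewrite ?lexx ?ler01//; exact: le_trans.
apply: mx_norm_le => // i j; rewrite !mxE.
pose p t := a + t *: (b - a).
pose g := (fun A : 'M[R]_(m, n) => A i j) \o (f \o p).
have lc := @lincont_coord R m n i j.
have dg (t : R) : 0 <= t <= 1 -> differentiable g t /\ 'D_1 g t = ('D_(b - a) f (p t)) i j.
  move=> t01; have [df _] := h _ t01; have [dp Dp] := derive_affine a (b - a) t.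
  have dfp : differentiable (f \o p) t by apply: differentiable_comp.
  split; first exact: (differentiable_comp dfp (lincont_diff _ lc)).
  rewrite /g (derive_linr _ lc dfp) (derive_comp _ dp df).
  by rewrite Dp.
have [||d + gE] := @MVT_segment R g (fun t => 'D_1 g t) 0 1 ler01.
- move=> t; rewrite in_itv/= => /andP[t0 t1].
  apply: DeriveDef => //; apply/diff_derivable.
  by apply: (dg t _).1; rewrite !ltW.
- apply: derivable_within_continuous => t; rewrite in_itv/= => t01.
  by apply/diff_derivable; exact: (dg t t01).1.
rewrite in_itv/= => d01; move: gE; rewrite subr0 mulr1 (dg _ d01).2.
rewrite /g /p /= scale1r scale0r addr0 (addrC a) subrK => ->.
by apply: le_trans (h _ d01).2; exact: mx_norm_coord.
Qed.

(** Continuity of the derivative in operator norm: it reduces to the continuity of finitely many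
    ['D_(b i) f], since the coordinates of v are bounded by multiples of its norm. *)
Lemma uniform_derive V W (x0 : V) (f : V -> W) (e : R) : fincoord V ->
  smooth_at x0 f -> 0 < e ->
  \forall x \near x0, forall v, `|'D_v f x - 'D_v f x0| <= e * `|v|.
Proof.
move=> [I [b [c [lc ve]]]] sf e0.
have /choice[K HK] : forall i, exists k : R, 0 < k /\ forall v, `|c i v| <= k * `|v|.
  move=> i; have [L [cL LE]] := lincont_pack (lc i).
  by have [k k0 hk] := linear_lipschitz cL; exists k; split=> // v; rewrite LE.
(* The summand 1 keeps the denominator positive even if there are no coordinates. *)
have K0 : 0 < 1 + \sum_i K i.
  by apply: ltr_wpDr => //; apply: sumr_ge0 => i _; exact/ltW/(HK i).1.
have : \forall x \near x0, forall i, `|'D_(b i) f x - 'D_(b i) f x0| <= e / (1 + \sum_i K i).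
  apply: filter_forall => i.
  have /smooth_at_cont/cvgrPdist_le/(_ (e / (1 + \sum_i K i))) := smooth_at_derive (b i) sf.
  by rewrite divr_gt0// => /(_ isT); apply: filterS => x; rewrite distrC.
apply: filterS2 (smooth_at_near sf) => x /smooth_at_diff dx h v.
have lx := lincont_derive_dir dx; have l0 := lincont_derive_dir (smooth_at_diff sf).
have -> : 'D_v f x - 'D_v f x0 = \sum_i c i v *: ('D_(b i) f x - 'D_(b i) f x0).
  rewrite {1 2}(ve v) (lincont_sum _ lx) (lincont_sum _ l0) -sumrB.
  by apply: eq_bigr => i _; rewrite (lincontZ _ _ lx) (lincontZ _ _ l0) scalerBr.
apply: le_trans (ler_norm_sum _ _ _) _.
apply: (@le_trans _ _ (\sum_i K i * `|v| * (e / (1 + \sum_i K i)))).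
  by apply: ler_sum => i _; rewrite normrZ ler_pM//; exact: (HK i).2.
rewrite -!mulr_suml mulrAC ler_wpM2r// mulrC -mulrA ler_piMr ?(ltW e0)//.
by rewrite mulrC ler_pdivrMr// mul1r lerDr.
Qed.
End Germs.

(** * Open mapping *)

(** The fixed point theorem behind [open_mapping] asks for a complete normed space of matrices. *)
HB.instance Definition _ (R : realType) (m n : nat) :=
  Uniform_isComplete.Build 'M[R]_(m, n) cauchy_cvg.

Section Inversion.
Context {R : realType}.
Implicit Types U V W : normedModType R.

(** Surjectivity by duality: the matrix whose rows are the images of the generators has full rank
    unless a nonzero C annihilates the image under the entrywise pairing. Its pseudo-inverse then
    yields the right inverse. *)
Lemma lin_surj V m n (D : V -> 'M[R]_(m, n)) : fincoord V -> linear D ->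
  (forall C : 'M[R]_(m, n),
     (forall v, \sum_i \sum_j D v i j * C i j = 0) -> C = 0) ->
  exists L : 'M[R]_(m, n) -> V, lincont L /\ forall w, D (L w) = w.
Proof.
move=> fV lD ann; have [I [b [c [lc ve]]]] := fV.
have [D' DE] := lin_pack lD.
pose A := \matrix_(i < #|I|) mxvec (D (b (enum_val i))).
have fullA : row_full A.
  rewrite -col_leq_rank -mxrank_tr leqNgt; apply/negP => rk.
  have : kermx A^T != 0.
    rewrite -mxrank_eq0 mxrank_ker -lt0n subn_gt0.
    by rewrite mxrank_tr in rk *.
  apply/negP; rewrite negbK; apply/eqP/row_matrixP => k; rewrite row0.
  set r := row k _.
  have rA : A *m r^T = 0.
    apply: trmx_inj; rewrite trmx_mul trmxK trmx0 /r -row_mul.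
    by rewrite mulmx_ker row0.
  have h i : \sum_a \sum_j D (b i) a j * vec_mx r a j = 0.
    have := congr1 (fun M : 'cV_#|I| => M (enum_rank i) 0) rA; rewrite !mxE => rE.
    rewrite -[RHS]rE pair_bigA /= [RHS](reindex _ (curry_mxvec_bij _ _)) /=.
    by apply: eq_bigr => -[a j] _; rewrite !mxE mxvecE enum_rankK.
  suff : vec_mx r = 0 by move/eqP; rewrite vec_mx_eq0 => /eqP.
  apply: ann => v; rewrite (ve v) DE linear_sum -DE.
  under eq_bigr do under eq_bigr do rewrite summxE mulr_suml.
  under eq_bigr do rewrite exchange_big.
  rewrite exchange_big big1// => k' _ /=.
  under eq_bigr do under eq_bigr do rewrite DE linearZ -DE mxE -mulrA.
  under eq_bigr do rewrite -mulr_sumr.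
  by rewrite -mulr_sumr h mulr0.
pose L (w : 'M[R]_(m, n)) :=
  \sum_i (mxvec w *m pinvmx A) 0 (enum_rank i) *: b i.
exists L; split.
  apply: fincoord_lincont; first exact: fincoord_mx.
  move=> a u v; rewrite /L scaler_sumr -big_split /=; apply: eq_bigr => i _.
  by rewrite linearP mulmxDl -scalemxAl !mxE scalerA scalerDl.
move=> w; apply: (can_inj mxvecK).
have /mulmxKpV <- : (mxvec w <= A)%MS by rewrite submx_full.
rewrite /L DE linear_sum -DE linear_sum /= [RHS]mulmx_sum_row.
rewrite [RHS](reindex (@enum_rank I)) /=; last first.
  exists enum_val => i _; [exact: enum_rankK|exact: enum_valK].
apply: eq_bigr => i _.
by rewrite rowK enum_rankK DE linearZ -DE linearZ.
Qed.
Lemma ball_segment V (x : V) (e : R) (a b : V) (t : R) : ball x e a -> ball x e b ->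
  0 <= t <= 1 -> ball x e (a + t *: (b - a)).
Proof.
rewrite -!ball_normE /ball_ /= => xa xb /andP[t0 t1].
have -> : x - (a + t *: (b - a)) = (1 - t) *: (x - a) + t *: (x - b).
  have -> : x - b = x - a - (b - a) by rewrite opprB addrA subrK.
  by rewrite [t *: (x - a - _)]scalerBr [RHS]addrA -scalerDl subrK scale1r opprD addrA.
apply: (le_lt_trans (ler_normD _ _)); rewrite !normrZ (ger0_norm t0) ger0_norm ?subr_ge0//.
have -> : e = (1 - t) * e + t * e by rewrite -mulrDl subrK mul1r.
have [->|tn0] := eqVneq t 0; first by rewrite subr0 !mul1r !mul0r !addr0.
rewrite ler_ltD//; first by rewrite ler_wpM2l ?subr_ge0// ltW.
by rewrite ltr_pM2l// lt0r tn0.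
Qed.

(** On the slice x0 + L w the derivative of g at w = 0 is the identity, so w - g (x0 + L w) is a
    contraction near 0, and g (x0 + L w) = y becomes a fixed point equation for w. *)
Lemma open_mapping V m n (g : V -> 'M[R]_(m, n)) (x0 : V) (L : 'M[R]_(m, n) -> V)
    (A : set V) : smooth_at x0 g -> lincont L -> (forall w, 'D_(L w) g x0 = w) ->
  nbhs x0 A -> \forall y \near g x0, exists2 x, A x & g x = y.
Proof.
move=> sg lL gL nA.
pose p (w : 'M[R]_(m, n)) := x0 + L w.
have sp w : smooth_at w p.
  have : smooth_at w ((fun z : V * V => z.1 + z.2) \o (fun w => (x0, L w))); last by [].
  apply: smooth_at_comp; last exact/smooth_at_lin/lincont_add.
  by apply: smooth_at_pair; [exact: smooth_at_cst|exact: smooth_at_lin].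
have p0 : p 0 = x0 by rewrite /p (lincont0 lL) addr0.
have Dp w v : 'D_v p w = L v.
  have -> : p = cst x0 + L by [].
  rewrite deriveD; [|exact/diff_derivable/differentiable_cst|exact/diff_derivable/lincont_diff].
  by rewrite derive_cst add0r lincont_derive.
have sG : smooth_at 0 (g \o p) by apply: smooth_at_comp => //; rewrite p0.
pose K (w : 'M[R]_(m, n)) := w - g (p w).
have sK : smooth_at 0 K.
  have sS : lincont (fun z : 'M[R]_(m, n) * 'M[R]_(m, n) => z.1 - z.2).
    apply: fincoord_lincont; first by apply: fincoord_prod; exact: fincoord_mx.
    by move=> a u v; rewrite /= scalerBr opprD addrACA.
  have : smooth_at 0 ((fun z : 'M[R]_(m, n) * 'M[R]_(m, n) => z.1 - z.2) \o
    (fun w => (w, (g \o p) w))); last by [].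
  apply: smooth_at_comp; last exact: smooth_at_lin.
  by apply: smooth_at_pair => //; exact/smooth_at_lin/lincont_id.
have K0 v : 'D_v K 0 = 0.
  have -> : K = id - (g \o p) by [].
  rewrite deriveB; [|exact: derivable_id|exact/diff_derivable/smooth_at_diff].
  rewrite derive_id derive_comp; [|exact: smooth_at_diff|by rewrite p0; exact: smooth_at_diff].
  by rewrite p0 Dp gL subrr.
have : \forall w \near (0 : 'M[R]_(m, n)), [/\ differentiable K w, A (p w) &
    forall v, `|'D_v K w| <= 2^-1 * `|v|].
  have h20 : 0 < (2 : R)^-1 by rewrite invr_gt0.
  have cp : \forall w \near (0 : 'M[R]_(m, n)), A (p w).
    by apply: (smooth_at_cont (sp 0)); rewrite p0.
  apply: filterS3 (smooth_at_near sK) cp (uniform_derive (@fincoord_mx R m n) sK h20).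
  move=> w /smooth_at_diff dK Aw h; split=> // v.
  by have := h v; rewrite K0 subr0.
move=> /nbhs_ballP[d d0 Hd].
(* The closed ball of radius [rho] lies inside the open ball on which the estimates hold. *)
pose rho := d / 2; have rho0 : 0 < rho by rewrite divr_gt0.
have rhod : rho < d by rewrite /rho ltr_pdivrMr// ltr_pMr// ltr1n.
pose B := [set w : 'M[R]_(m, n) | `|w| <= rho].
have BD w : B w -> ball 0 d w.
  by rewrite -ball_normE /= sub0r normrN => /le_lt_trans; apply.
have lipK a b : B a -> B b -> `|K b - K a| <= 2^-1 * `|b - a|.
  move=> /BD Ba /BD Bb; apply: mean_value_mx => t t01.
  by have [? _ ?] := Hd _ (ball_segment Ba Bb t01); split.
have B0 : B 0 by rewrite /B /= normr0 ltW.
(* One half of [rho] is for y - g x0, the other for the contraction by 1/2 on the ball of radius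
   [rho]. *)
apply/nbhs_ballP; exists (rho / 2) => /=; first by rewrite divr_gt0.
move=> y yg.
have KB w : B w -> B (y + K w).
  move=> Bw; rewrite /B /=.
  have -> : y + K w = (y - g x0) + (K w - K 0).
    by rewrite /K p0 sub0r opprK (addrC _ (g x0)) [RHS]addrA subrK.
  apply: le_trans (ler_normD _ _) _; rewrite (splitr rho) lerD//.
    by apply/ltW; move: yg; rewrite -ball_normE /= distrC.
  apply: le_trans (lipK _ _ B0 Bw) _.
  by rewrite subr0 mulrC ler_wpM2r// invr_ge0.
pose fM := isFun.Build _ _ B B (fun w => y + K w) KB.
pose f := HB.pack (fun w => y + K w) fM : {fun B >-> B}.
have [|||w Bw wE] := @banach_fixed_point R 'M[R]_(m, n) B f.
- have q0 : 0 <= (2 : R)^-1 by rewrite invr_ge0.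
  exists (NngNum q0); split=> /=; first by rewrite invf_lt1// ltr1n.
  move=> -[a b] [/= Ba Bb].
  by rewrite opprD addrACA subrr add0r; exact: lipK.
- have -> : B = closed_ball_ (fun w => `|w|) 0 rho.
    by apply/seteqP; split=> w; rewrite /B /closed_ball_ /= sub0r normrN.
  exact: closed_closed_ball_.
- by exists 0.
exists (p w); first by have [] := Hd _ (BD _ Bw).
move/eqP: wE; rewrite /f /= /K addrCA -subr_eq0 opprD addrA subrr add0r oppr_eq0.
by rewrite subr_eq0 => /eqP.
Qed.

Lemma lincont_bounded V W (L : V -> W) : lincont L ->
  exists2 k, 0 < k & forall v, `|L v| <= k * `|v|.
Proof.
by move=> /lincont_pack[L' [cL ->]]; have [k k0 hk] := linear_lipschitz cL; exists k.
Qed.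

Lemma lin_inj_inverse m n (B : 'rV[R]_m -> 'rV[R]_n) : linear B ->
  (forall w, B w = 0 -> w = 0) ->
  exists2 A : 'rV[R]_n -> 'rV[R]_m, lincont A & forall w, A (B w) = w.
Proof.
move=> /lin_pack[B' ->] injB; pose b := lin1_mx B'.
have fb : row_free b.
  rewrite -kermx_eq0; apply/eqP/row_matrixP => i; rewrite row0; apply: injB.
  by rewrite -mul_rV_lin1 -/b -row_mul mulmx_ker row0.
exists (fun v => v *m pinvmx b).
  apply: fincoord_lincont; first exact: fincoord_mx.
  by move=> c u v; rewrite mulmxDl scalemxAl.
by move=> w; rewrite -mul_rV_lin1 -mulmxA mulmxVp// mulmx1.
Qed.

Lemma near_injective V m n (f : V -> 'rV[R]_n) (x0 : V) (i : 'rV[R]_m -> V) :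
  fincoord V -> smooth_at x0 f -> linear i ->
  (forall w, 'D_(i w) f x0 = 0 -> w = 0) ->
  \forall x \near x0, forall w, 'D_(i w) f x = 0 -> w = 0.
Proof.
move=> fV sf li inj.
have ci := fincoord_lincont (@fincoord_mx R 1 m) li.
have lB := lincont_comp ci (lincont_derive_dir (smooth_at_diff sf)).
have [A lA AB] := lin_inj_inverse lB.1 inj.
have [a a0 Aa] := lincont_bounded lA; have [k k0 ik] := lincont_bounded ci.
(* With a bounding the left inverse and k bounding i, this perturbation size gives |w| <= |w| / 2
   for every w in the kernel at x. *)
have e0 : 0 < (2 * (a * k))^-1 by rewrite invr_gt0 !mulr_gt0.
apply: filterS (uniform_derive fV sf e0) => x h w xw.
apply/eqP; rewrite -normr_eq0 eq_le normr_ge0 andbT.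
have : `|w| <= 2^-1 * `|w|.
  rewrite -[in leLHS](AB w); apply: le_trans (Aa _) _.
  have := h (i w); rewrite xw sub0r normrN => h'.
  have : a * `|'D_(i w) f x0| <= a * ((2 * (a * k))^-1 * (k * `|w|)).
    rewrite ler_wpM2l ?(ltW a0)//; apply: le_trans h' _.
    by rewrite ler_wpM2l// ltW.
  move/le_trans; apply; rewrite le_eqVlt; apply/orP; left; apply/eqP.
  by field; rewrite !gt_eqF.
by lra.
Qed.

End Inversion.

(** * Derivatives of tangent maps and mixed second derivatives *)

Section SecondTangent.
Context {R : realType}.
Implicit Types U V W : normedModType R.

Lemma derive_slot1 U V W (F : U * V -> W) x v d :
  'D_(d, 0 : V) F (x, v) = 'D_d (fun y => F (y, v)) x.
Proof.
rewrite /derive; set P := (X in lim (X @ _)); set Q := (X in _ = lim (X @ _)).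
suff -> : P = Q by [].
apply/funext => h; rewrite /P /Q /=; congr (_ *: (F _ - _)).
by congr pair; rewrite /= scaler0 add0r.
Qed.

Lemma derive_slot2 U V W (F : U * V -> W) x v d :
  'D_(0 : U, d) F (x, v) = 'D_d (fun y => F (x, y)) v.
Proof.
rewrite /derive; set P := (X in lim (X @ _)); set Q := (X in _ = lim (X @ _)).
suff -> : P = Q by [].
apply/funext => h; rewrite /P /Q /=; congr (_ *: (F _ - _)).
by congr pair; rewrite /= scaler0 add0r.
Qed.

Lemma deriveDir V W (f : V -> W) x u v : differentiable f x ->
  'D_(u + v) f x = 'D_u f x + 'D_v f x.
Proof. by move=> /lincont_derive_dir /lincontD ->. Qed.

Lemma deriveDirB V W (f : V -> W) x u v : differentiable f x ->
  'D_(u - v) f x = 'D_u f x - 'D_v f x.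
Proof. by move=> /lincont_derive_dir /lincontB ->. Qed.

Lemma deriveDirZ V W (f : V -> W) x (a : R) v : differentiable f x ->
  'D_(a *: v) f x = a *: 'D_v f x.
Proof. by move=> /lincont_derive_dir /lincontZ ->. Qed.

(** A direction that fixes the base point sees only the linear dependence of the tangent map on its
    vector argument. The equation u = 0 allows u to be any derivative known to vanish. *)
Lemma derive_tgt2 V W (f : V -> W) x v u d : differentiable f x -> u = 0 ->
  'D_(u, d) (tgt f) (x, v) = 'D_d f x.
Proof.
move=> df ->; rewrite derive_slot2 /tgt /=.
by rewrite (lincont_derive _ _ (lincont_derive_dir df)).
Qed.

Lemma derive_tgt V W (f : V -> W) x v d e : smooth_at x f ->
  'D_(d, e) (tgt f) (x, v) = 'D_d ('D_v f) x + 'D_e f x.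
Proof.
move=> sf; have -> : (d, e) = (d, 0) + (0, e) :> V * V.
  by congr pair; rewrite /= ?addr0 ?add0r.
rewrite deriveDir; last exact/smooth_at_diff/smooth_at_tgt.
by rewrite (derive_tgt2 v e (smooth_at_diff sf) erefl) derive_slot1.
Qed.

Lemma derive_const_dir V W (G : V -> W) (x v : V) :
  (\forall h \near (0 : R), G (h *: v + x) = G x) -> 'D_v G x = 0.
Proof.
move=> h; rewrite /derive; apply: cvg_lim => //.
apply: (@cvg_trans _ ((fun _ : R => 0 : W) @ 0^')); last exact: cvg_cst.
apply: near_eq_cvg; apply: (@cvg_within _ (nbhs (0 : R))).
by apply: filterS h => t /= ->; rewrite subrr scaler0.
Qed.

Lemma near_ballP V (x : V) (P : V -> Prop) :
  (\forall y \near x, P y) <-> exists2 e : R, 0 < e & forall y, ball x e y -> P y.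
Proof.
split; first by move=> /nbhs_ballP[e e0 h]; exists e.
by move=> [e e0 h]; apply/nbhs_ballP; exists e.
Qed.

(* f is invariant under small translations along v, hence so are all its directional
   derivatives: no symmetry of second derivatives is needed. *)
Lemma derive_derive0 V m n (f : V -> 'M[R]_(m, n)) (x0 v : V) : smooth_at x0 f ->
  (\forall x \near x0, 'D_v f x = 0) ->
  \forall x \near x0, forall w, 'D_v ('D_w f) x = 0.
Proof.
move=> /smooth_at_near sf fv.
have /near_ballP[e e0 he] : \forall x \near x0, differentiable f x /\ 'D_v f x = 0.
  by apply: filterS2 sf fv => x /smooth_at_diff.
apply/near_ballP; exists (e / 2); first by rewrite divr_gt0.
move=> x x0x w; apply: derive_const_dir.
have cv : (fun h : R => h *: v) @ (0 : R) --> (0 : V).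
  by rewrite -[X in _ --> X](scale0r v); exact: scalel_continuous.
(* The radii e/2 for x, e/4 for y around x and e/4 for the translation add up to e, so y and its
   translate both stay in the ball. *)
have e40 : 0 < e / 4 by rewrite divr_gt0.
have /cvgr0Pnorm_lt/(_ _ e40) := cv.
apply: filterS => h hv.
have -> : 'D_w f (h *: v + x) = 'D_w (fun y => f (h *: v + y)) x.
  rewrite /derive; set P := (X in lim (X @ _)); set Q := (X in _ = lim (X @ _)).
  suff -> : P = Q by [].
  by apply/funext => t; rewrite /P /Q /= addrCA.
apply: near_eq_derive; apply/near_ballP; exists (e / 4) => // y xy.
have [b1 b2] : ball x0 e y /\ ball x0 e (h *: v + y).
  move: x0x xy; rewrite -!ball_normE /= => x0x xy; split.
    rewrite -[x0 - y](subrKA x) (le_lt_trans (ler_normD _ _))//.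
    by lra.
  have -> : x0 - (h *: v + y) = (x0 - x) + (x - y) - h *: v.
    by rewrite addrA subrK opprD addrAC addrA.
  apply: le_lt_trans (ler_normB _ _) _.
  have := ler_normD (x0 - x) (x - y).
  by lra.
apply/eqP; rewrite -subr_eq0 -normr_le0; apply: mean_value_mx => t t01.
have [d0 d1] := he _ (ball_segment b1 b2 t01); split=> //.
move: d0 d1; rewrite addrK => d0 d1.
by rewrite deriveDirZ// d1 scaler0 normr0.
Qed.

Lemma near_preimage V W (K : V -> W) (x0 : V) (P : W -> Prop) :
  {for x0, continuous K} -> (\forall y \near K x0, P y) ->
  \forall x \near x0, P (K x).
Proof. by move=> cK h; apply: cK. Qed.

Lemma chain_linear U V W (g : V -> W) (K : U -> V) (L : U -> W) (x0 : U) :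
  smooth_at x0 K -> smooth_at (K x0) g -> lincont L ->
  (\forall x \near x0, g (K x) = L x) ->
  \forall x \near x0, forall d, 'D_('D_d K x) g (K x) = L d.
Proof.
move=> sK sg lL /near_derive gK.
have cK : \forall x \near x0, smooth_at (K x) g.
  exact: (near_preimage (P := fun y => smooth_at y g) (smooth_at_cont sK)
    (smooth_at_near sg)).
apply: filterS3 gK (smooth_at_near sK) cK => x h /smooth_at_diff dK /smooth_at_diff dg d.
by rewrite -(lincont_derive x d lL) -h -(derive_comp _ dK dg).
Qed.
End SecondTangent.

(** * Linear maps between dimensions m and m + 1 *)

Section LinearAlgebra.
Context {R : realType}.

Lemma ker_line m (D : 'rV[R]_m.+1 -> 'rV[R]_m) (t x : 'rV[R]_m.+1) : linear D ->
  (forall e, exists d, D d = e) -> t != 0 -> D t = 0 -> D x = 0 ->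
  exists a, x = a *: t.
Proof.
move=> /lin_pack[D' ->] sD t0 Dt Dx; pose d := lin1_mx D'.
have fd : row_full d.
  rewrite -sub1mx; apply/row_subP => i; have [y <-] := sD (row i 1%:M).
  by rewrite -mul_rV_lin1 submxMl.
have kd y : D' y = 0 -> (y <= kermx d)%MS.
  by move=> Dy; apply/sub_kermxP; rewrite mul_rV_lin1.
have rk : \rank (kermx d) = 1%N by rewrite mxrank_ker (eqP fd) subSnn.
have : (kermx d <= t)%MS.
  by rewrite -(geq_leqif (mxrank_leqif_sup (kd _ Dt))) rk rank_rV t0.
by move=> /(submx_trans (kd _ Dx))/sub_rVP.
Qed.

Lemma not_surj_row m (B : 'rV[R]_m -> 'rV[R]_m.+1) : linear B ->
  ~ forall w, exists u, B u = w.
Proof.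
move=> /lin_pack[B' ->] sB; pose b := lin1_mx B'.
have fb : row_full b.
  rewrite -sub1mx; apply/row_subP => i; have [y <-] := sB (row i 1%:M).
  by rewrite -mul_rV_lin1 submxMl.
by have := rank_leq_row b; rewrite (eqP fb) ltnn.
Qed.

Lemma ker_nontrivial m (D : 'rV[R]_m.+1 -> 'rV[R]_m) : linear D ->
  exists2 t, t != 0 & D t = 0.
Proof.
move=> /lin_pack[D' ->]; pose d := lin1_mx D'.
have : kermx d != 0.
  rewrite -mxrank_eq0 mxrank_ker -lt0n subn_gt0 ltnS; exact: rank_leq_col.
move=> /rowV0Pn[t tk t0]; exists t => //.
by move/sub_kermxP: tk; rewrite mul_rV_lin1.
Qed.
End LinearAlgebra.

(** * Functions of the jet of the output *)

Lemma near_always (R : realType) (V : normedModType R) (x0 : V) (P : V -> Prop) :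
  (forall y, P y) -> \forall y \near x0, P y.
Proof. by move=> h; exact: nearW. Qed.

Lemma near_and (R : realType) (V : normedModType R) (x0 : V) (P Q : V -> Prop) :
  (\forall y \near x0, P y) -> (\forall y \near x0, Q y) ->
  \forall y \near x0, P y /\ Q y.
Proof. exact: filterI. Qed.

Lemma near_all (R : realType) (V : normedModType R) (x0 : V) (I : finType)
    (c : pred I) (P : I -> V -> Prop) :
  (forall i, c i -> \forall y \near x0, P i y) ->
  \forall y \near x0, forall i, c i -> P i y.
Proof.
move=> h; apply: filter_forall => i; have [ci|ci] := boolP (c i).
  by apply: filterS (h i ci).
exact: nearW.
Qed.

Lemma lincont_inr (R : realType) (V W : normedModType R) :
  lincont (fun w : W => (0, w) : V * W).
Proof.
split=> [a u v|x]; first by congr pair; rewrite /= scaler0 addr0.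
by apply: cvg_pair; [exact: cvg_cst|exact: cvg_id].
Qed.

Lemma smooth_at_affine (R : realType) (V W : normedModType R) (x : V) (L : V -> W)
    (w : W) : lincont L -> smooth_at x (fun y => L y + w).
Proof.
move=> lL; have : smooth_at x ((fun z : W * W => z.1 + z.2) \o (fun y => (L y, w))); last by [].
apply: smooth_at_comp; last exact/smooth_at_lin/lincont_add.
by apply: smooth_at_pair; [exact: smooth_at_lin|exact: smooth_at_cst].
Qed.

Section OutputJets.
Context {R : realType} {N m : nat}.
Local Notation MM := 'M[R]_(N, m).
Local Notation yd := (@y_dir R m N).
Implicit Types Y X : MM.

(* y_[k]; the zero row if k >= N. *)
Definition jrow (k : nat) Y : 'rV[R]_m :=
  \row_j (if insub k is Some i then Y i j else 0).

Lemma jrow_ord (i : 'I_N) Y j : jrow i Y 0 j = Y i j.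
Proof. by rewrite mxE valK. Qed.

Lemma jrow_out k Y : (N <= k)%N -> jrow k Y = 0.
Proof. by move=> Nk; apply/rowP => j; rewrite !mxE insubF// ltnNge Nk. Qed.

Lemma jrow_lincont k : lincont (jrow k).
Proof.
apply: fincoord_lincont; first exact: fincoord_mx.
move=> a u v; apply/rowP => j; rewrite !mxE; case: insub => [i|]; rewrite ?mxE//.
by rewrite mulr0 addr0.
Qed.

Lemma jrow_inj Y X : (forall k, (k < N)%N -> jrow k Y = jrow k X) -> Y = X.
Proof. by move=> h; apply/matrixP => i j; rewrite -!jrow_ord h. Qed.

Lemma jrow_yd k k' j : (k < N)%N -> jrow k (yd k' j) = (k == k')%:R *: delta_mx 0 j.
Proof.
move=> kN; apply/rowP => b; rewrite (jrow_ord (Ordinal kN)) !mxE eqxx /=.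
by case: (k == k'); case: (b == j); rewrite ?mulr1 ?mulr0.
Qed.

Lemma jrow_yd_ne k k' j : k != k' -> jrow k (yd k' j) = 0.
Proof.
move=> /negPf kk'; have [kN|Nk] := ltnP k N; last exact: jrow_out.
by rewrite jrow_yd// kk' scale0r.
Qed.

Lemma yd_out k j : (N <= k)%N -> yd k j = 0.
Proof.
move=> Nk; apply/matrixP => a b; rewrite !mxE.
by have /negPf-> : a != k :> nat by rewrite neq_ltn (leq_trans (ltn_ord a) Nk).
Qed.

Definition shift_rows Y : MM := \matrix_(k, j) jrow k.+1 Y 0 j.

Lemma jrow_shift k Y : jrow k (shift_rows Y) = jrow k.+1 Y.
Proof.
have [kN|Nk] := ltnP k N; last by rewrite !jrow_out// (leq_trans Nk).
by apply/rowP => j; rewrite (jrow_ord (Ordinal kN)) mxE.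
Qed.

Lemma shift_lincont : lincont shift_rows.
Proof.
apply: fincoord_lincont; first exact: fincoord_mx.
by move=> a u v; apply: jrow_inj => k kN; have l := jrow_lincont k;
  rewrite (lincontD _ _ l) (lincontZ _ _ l) !jrow_shift (jrow_lincont _).1.
Qed.

Lemma shift_yd k j : (k.+1 < N)%N -> shift_rows (yd k.+1 j) = yd k j.
Proof.
move=> kN; apply: jrow_inj => k' k'N; rewrite jrow_shift.
have [k'N'|Nk'] := ltnP k'.+1 N; first by rewrite !jrow_yd.
rewrite jrow_out// jrow_yd//; have /negPf-> : k' != k by lia.
by rewrite scale0r.
Qed.

Lemma sum_yd Y : Y = \sum_i \sum_j Y i j *: yd i j.
Proof.
rewrite {1}(matrix_sum_delta Y); apply: eq_bigr => i _; apply: eq_bigr => j _.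
congr (_ *: _); apply/matrixP => a b; rewrite !mxE.
by [].
Qed.

Lemma derive_sum_yd (W : normedModType R) (H : MM -> W) Y X : differentiable H Y ->
  'D_X H Y = \sum_i \sum_j X i j *: 'D_(yd i j) H Y.
Proof.
move=> /lincont_derive_dir lH; rewrite {1}(sum_yd X) (lincont_sum _ lH).
apply: eq_bigr => i _; rewrite (lincont_sum _ lH).
by apply: eq_bigr => j _; rewrite (lincontZ _ _ lH).
Qed.

Definition freeze (good : nat -> 'I_m -> bool) (Y0 Y : MM) : MM :=
  \matrix_(k, j) if good k j then Y k j else Y0 k j.

Lemma freeze_ball good Y0 Y e : ball Y0 e Y -> ball Y0 e (freeze good Y0 Y).
Proof.
rewrite -!ball_normE /= => h; apply: le_lt_trans h; apply: mx_norm_le => // i j.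
rewrite !mxE; case: ifP => _; last by rewrite subrr normr0.
by have := mx_norm_coord (Y0 - Y) i j; rewrite !mxE.
Qed.

Lemma freeze_eq (good : nat -> 'I_m -> bool) Y0 n (H : MM -> 'rV[R]_n) : smooth_at Y0 H ->
  (forall (k : 'I_N) j, ~~ good k j -> \forall Y \near Y0, 'D_(yd k j) H Y = 0) ->
  \forall Y \near Y0, H Y = H (freeze good Y0 Y).
Proof.
move=> sH h.
have h' : \forall Y \near Y0, forall kj : 'I_N * 'I_m, ~~ good kj.1 kj.2 ->
    'D_(yd kj.1 kj.2) H Y = 0.
  by apply: near_all => -[k j] /=; exact: h.
have /near_ballP[e e0 he] : \forall Y \near Y0, differentiable H Y /\
    forall kj : 'I_N * 'I_m, ~~ good kj.1 kj.2 -> 'D_(yd kj.1 kj.2) H Y = 0.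
  by apply: filterS2 (smooth_at_near sH) h' => Y /smooth_at_diff.
apply/near_ballP; exists e => // Y bY; have bF := freeze_ball good bY.
apply/eqP; rewrite -subr_eq0 -normr_le0; apply: mean_value_mx => t t01.
have [dH z] := he _ (ball_segment bF bY t01); split=> //.
rewrite derive_sum_yd// big1 ?normr0// => k _; rewrite big1// => j _.
rewrite !mxE; case: (boolP (good k j)) => g; first by rewrite subrr scale0r.
by rewrite (z (k, j))// scaler0.
Qed.

Lemma freeze_smooth good (W : normedModType R) (H : MM -> W) Y0 : smooth_at Y0 H ->
  smooth_at Y0 (H \o freeze good Y0).
Proof.
move=> sH; have F0 : freeze good Y0 Y0 = Y0 by apply/matrixP => i j; rewrite mxE if_same.
apply: smooth_at_comp; last by rewrite F0.
pose P (Y : MM) : MM := \matrix_(k, j) if good k j then Y k j else 0.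
pose C : MM := \matrix_(k, j) if good k j then 0 else Y0 k j.
have lP : lincont P.
  apply: fincoord_lincont; first exact: fincoord_mx.
  move=> a u v; apply/matrixP => i j; rewrite !mxE; case: ifP => // _.
  by rewrite mulr0 addr0.
rewrite (_ : freeze good Y0 = fun Y => P Y + C); first exact: smooth_at_affine.
apply/funext => Y; apply/matrixP => i j; rewrite !mxE.
by case: ifP => _; rewrite ?addr0 ?add0r.
Qed.

(* The total time derivative of H, provided that H does not depend on the last row:
   [shift_rows] has no value for its derivative and puts 0. *)
Definition dtot (W : normedModType R) (H : MM -> W) Y := 'D_(shift_rows Y) H Y.

(** Its negation is [depends_explicitly], with j and k exchanged. *)
Definition indep_of (W : normedModType R) (H : MM -> W) (Y0 : MM) k j :=
  \forall Y \near Y0, 'D_(yd k j) H Y = 0.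

Lemma smooth_dtot (W : normedModType R) (H : MM -> W) Y0 :
  smooth_at Y0 H -> smooth_at Y0 (dtot H).
Proof.
move=> sH; have : smooth_at Y0 (tgt H \o (fun Y => (Y, shift_rows Y))); last by [].
apply: smooth_at_comp; last exact: smooth_at_tgt.
by apply: smooth_at_pair; apply: smooth_at_lin; [exact: lincont_id|exact: shift_lincont].
Qed.

Lemma derive_dtot (W : normedModType R) (H : MM -> W) Y X : smooth_at Y H ->
  'D_X (dtot H) Y = 'D_X ('D_(shift_rows Y) H) Y + 'D_(shift_rows X) H Y.
Proof.
move=> sH; pose K Z := (Z, shift_rows Z).
have lK : lincont K by apply: lincont_pair; [exact: lincont_id|exact: shift_lincont].
have -> : dtot H = tgt H \o K by [].
by rewrite (derive_linl _ _ _ lK) derive_tgt.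
Qed.

(** Of the two terms in [derive_dtot], the mixed second derivative vanishes by [derive_derive0], and
    in the other the shift lowers the order of the direction by one. *)
Lemma derive_dtot_indep n (H : MM -> 'rV[R]_n) Y0 k j : (k.+1 < N)%N ->
  smooth_at Y0 H -> indep_of H Y0 k.+1 j ->
  \forall Y \near Y0, 'D_(yd k.+1 j) (dtot H) Y = 'D_(yd k j) H Y.
Proof.
move=> kN sH /(derive_derive0 sH); apply: filterS2 (smooth_at_near sH) => Y sY h.
by rewrite derive_dtot// h add0r shift_yd.
Qed.

Lemma indep_out (W : normedModType R) (H : MM -> W) Y0 k j :
  (N <= k)%N -> indep_of H Y0 k j.
Proof. by move=> Nk; apply: near_always => Y; rewrite yd_out// derive0. Qed.

Lemma function_of_derive (W : normedModType R) (r : 'I_m -> nat) c (H : MM -> W) k j Y :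
  function_of r c H -> (r j < k + c)%N -> 'D_(yd k j) H Y = 0.
Proof.
move=> fH rk; apply: derive_const_dir; apply: near_always => h; apply: fH => a b ab.
rewrite !mxE; have [ak|] := eqVneq (a : nat) k; last by rewrite mulr0 add0r.
have [bj|] := eqVneq b j; last by rewrite mulr0 add0r.
by move: ab rk; rewrite ak bj leqNgt => /negPf->.
Qed.

Lemma function_of_dir (W : normedModType R) (r : 'I_m -> nat) c (H : MM -> W) Y X X' :
  function_of r c H ->
  (forall (k : 'I_N) j, (k + c <= r j)%N -> X k j = X' k j) -> 'D_X H Y = 'D_X' H Y.
Proof.
move=> fH XX; rewrite /derive; set F := (X in lim (X @ _)).
set G := (X in _ = lim (X @ _)); suff -> : F = G by [].
apply/funext => h; rewrite /F /G /=; congr (_ *: (_ - _)); apply: fH => k j kj.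
by rewrite !mxE XX.
Qed.
End OutputJets.

(** * Orders of differentiation in q, v and u for a second-order system *)

Section Parameterization.
Context {R : realType} {N m p : nat} (r : 'I_m -> nat).
Local Notation MM := 'M[R]_(N, m).
Local Notation yd := (@y_dir R m N).
Context (Fq Fv : MM -> 'rV[R]_p) (Fu : MM -> 'rV[R]_m)
  (f : 'rV[R]_p * 'rV[R]_p * 'rV[R]_m -> 'rV[R]_p) (Y0 : MM).
Context (rN : forall j, (r j < N)%N)
  (fq : function_of r 1 Fq) (fv : function_of r 1 Fv)
  (sq : smooth_at Y0 Fq) (sv : smooth_at Y0 Fv) (su : smooth_at Y0 Fu)
  (sf : smooth_at (Fq Y0, Fv Y0, Fu Y0) f)
  (qv : \forall Y \near Y0, dtot Fq Y = Fv Y)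
  (vf : \forall Y \near Y0, dtot Fv Y = f (Fq Y, Fv Y, Fu Y)).

Lemma derive_v_eq k j : (k.+1 < N)%N -> indep_of Fq Y0 k.+1 j ->
  \forall Y \near Y0, 'D_(yd k.+1 j) Fv Y = 'D_(yd k j) Fq Y.
Proof.
move=> kN h; apply: filterS2 (near_derive qv) (derive_dtot_indep kN sq h) => Y e1 e2.
by rewrite -e1 e2.
Qed.

(** For r^j = k + 1 the coefficient of y^j_[k] in q reappears in v as that of y^j_[k+1], an order
    which v does not contain; for smaller r^j the claim is part of [fq]. This is the gain from R - 1
    to R - 2 for q. *)
Lemma indep_q_top k j : (r j < k.+2)%N -> indep_of Fq Y0 k j.
Proof.
move=> rk; have [rk1|rk1] := ltnP (r j) k.+1.
  by apply: near_always => Y; apply: (function_of_derive _ fq); rewrite addn1.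
have kN : (k.+1 < N)%N by exact: leq_ltn_trans rk1 (rN j).
have h : indep_of Fq Y0 k.+1 j.
  by apply: near_always => Y; apply: (function_of_derive _ fq); rewrite addn1.
apply: filterS (derive_v_eq kN h) => Y <-.
by apply: (function_of_derive _ fv); rewrite addn1.
Qed.

Lemma derive_f_along : \forall Y \near Y0, forall X,
  'D_('D_X Fq Y, 'D_X Fv Y, 'D_X Fu Y) f (Fq Y, Fv Y, Fu Y) = 'D_X (dtot Fv) Y.
Proof.
pose K Y := (Fq Y, Fv Y, Fu Y).
have sK : smooth_at Y0 K by do 2![apply: smooth_at_pair => //].
have sfK : \forall Y \near Y0, smooth_at (K Y) f.
  exact: (near_preimage (P := fun z => smooth_at z f) (smooth_at_cont sK)
    (smooth_at_near sf)).
have sqv := smooth_at_pair (smooth_at_pair sq sv) su.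
have h1 : \forall Y \near Y0, [/\ differentiable Fq Y, differentiable Fv Y & differentiable Fu Y].
  by apply: filterS3 (smooth_at_near sq) (smooth_at_near sv) (smooth_at_near su)
    => Y /smooth_at_diff ? /smooth_at_diff ? /smooth_at_diff.
apply: filterS3 (near_derive vf) sfK h1 => Y e /smooth_at_diff dK [dq dv du] X.
rewrite e.
have dqv := differentiable_pair dq dv.
have dK' : differentiable K Y by exact: differentiable_pair.
rewrite -[RHS](_ : 'D_X (f \o K) Y = _)// (derive_comp X dK' dK).
by rewrite (derive_pair X dqv du) (derive_pair X dq dv).
Qed.

Lemma indep_v k j : (k.+1 < N)%N -> indep_of Fq Y0 k j -> indep_of Fq Y0 k.+1 j ->
  indep_of Fv Y0 k.+1 j.
Proof.
move=> kN h h1; apply: filterS2 h (derive_v_eq kN h1) => Y e1 e2.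
by rewrite e2.
Qed.

Lemma derive_a_eq k j : (k.+1 < N)%N -> indep_of Fq Y0 k.+1 j -> indep_of Fv Y0 k.+1 j ->
  \forall Y \near Y0, 'D_(0, 0, 'D_(yd k.+1 j) Fu Y) f (Fq Y, Fv Y, Fu Y) =
    'D_(yd k j) Fv Y.
Proof.
move=> kN hq hv.
have h1 : \forall Y \near Y0, 'D_(yd k.+1 j) Fq Y = 0 /\ 'D_(yd k.+1 j) Fv Y = 0.
  by apply: filterS2 hq hv.
apply: filterS3 derive_f_along (derive_dtot_indep kN sv hv) h1 => Y e1 e2 [z1 z2].
by rewrite -e2 -e1 z1 z2.
Qed.

Lemma depends_v k j : (k.+1 < N)%N -> indep_of Fq Y0 k.+1 j ->
  ~ indep_of Fq Y0 k j -> ~ indep_of Fv Y0 k.+1 j.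
Proof.
move=> kN h nq nv; apply: nq.
by apply: filterS2 nv (derive_v_eq kN h) => Y e1 e2; rewrite -e2.
Qed.

Lemma depends_u k j : (k.+2 < N)%N -> indep_of Fq Y0 k.+1 j -> indep_of Fq Y0 k.+2 j ->
  ~ indep_of Fq Y0 k j -> ~ indep_of Fu Y0 k.+2 j.
Proof.
move=> kN h1 h2 nq nu; apply: (depends_v (ltnW kN) h1 nq).
apply: filterS2 nu (derive_a_eq kN h2 (indep_v kN h1 h2)) => Y e1 <-.
by rewrite e1 derive0.
Qed.

(** [derive_a_eq] controls the derivative of Fu only through its image under df/du, hence the
    injectivity hypothesis. *)
Lemma indep_u k j :
  (\forall Y \near Y0, forall w, 'D_(0, 0, w) f (Fq Y, Fv Y, Fu Y) = 0 -> w = 0) ->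
  indep_of Fq Y0 k j -> indep_of Fq Y0 k.+1 j -> indep_of Fq Y0 k.+2 j ->
  indep_of Fu Y0 k.+2 j.
Proof.
move=> inj h0 h1 h2; have [kN|Nk] := ltnP k.+2 N; last exact: indep_out.
apply: filterS3 inj (indep_v (ltnW kN) h0 h1) (derive_a_eq kN h2 (indep_v kN h1 h2)).
by move=> Y inj e1 e2; apply: inj; rewrite e2 e1.
Qed.
End Parameterization.

(** * One input less than configuration variables *)

Section ConfigurationOutput.
Context {R : realType} {N m : nat} (r : 'I_m -> nat).
Local Notation MM := 'M[R]_(N, m).
Local Notation yd := (@y_dir R m N).
Local Notation Q := 'rV[R]_m.+1.
Context (Fq Fv : MM -> Q) (Fu : MM -> 'rV[R]_m)
  (f : Q * Q * 'rV[R]_m -> Q) (h : Q -> 'rV[R]_m) (Y0 : MM).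
Context (rN : forall j, (r j < N)%N)
  (fq : function_of r 1 Fq) (fv : function_of r 1 Fv)
  (sq : smooth_at Y0 Fq) (sv : smooth_at Y0 Fv) (su : smooth_at Y0 Fu)
  (sf : smooth_at (Fq Y0, Fv Y0, Fu Y0) f)
  (qv : \forall Y \near Y0, dtot Fq Y = Fv Y)
  (vf : \forall Y \near Y0, dtot Fv Y = f (Fq Y, Fv Y, Fu Y))
  (sh : smooth_at (Fq Y0) h)
  (hsurj : \forall q \near Fq Y0, forall e, exists d, 'D_d h q = e)
  (hy : \forall Y \near Y0, h (Fq Y) = jrow 0 Y).

Lemma output_eq0 : \forall Y \near Y0, forall X,
  'D_('D_X Fq Y) h (Fq Y) = jrow 0 X.
Proof. exact: chain_linear sq sh (jrow_lincont 0) hy. Qed.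

Lemma output_eq1 : \forall Y \near Y0, forall X,
  'D_('D_X Fq Y, 'D_X Fv Y) (tgt h) (Fq Y, Fv Y) = jrow 1 X.
Proof.
have hy1 : \forall Y \near Y0, tgt h (Fq Y, Fv Y) = jrow 1 Y.
  by apply: filterS2 output_eq0 qv => Y e1 e2; rewrite -e2 /tgt /= e1 jrow_shift.
have := chain_linear (smooth_at_pair sq sv) (smooth_at_tgt _ sh) (jrow_lincont 1) hy1.
apply: filterS3 (smooth_at_near sq) (smooth_at_near sv) => Y /smooth_at_diff dq
  /smooth_at_diff dv e X.
by rewrite -e derive_pair.
Qed.

(** The second time derivative of h (q) is [tgt (tgt h)] at ((q, v), (v, vdot)); iterating the
    tangent map avoids writing out second derivatives of h. *)
Lemma output_eq2 : \forall Y \near Y0, forall X,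
  'D_(('D_X Fq Y, 'D_X Fv Y), ('D_X Fv Y, 'D_X (dtot Fv) Y)) (tgt (tgt h))
    ((Fq Y, Fv Y), (Fv Y, dtot Fv Y)) = jrow 2 X.
Proof.
have hy2 : \forall Y \near Y0,
    tgt (tgt h) ((Fq Y, Fv Y), (Fv Y, dtot Fv Y)) = jrow 2 Y.
  apply: filterS2 output_eq1 qv => Y e1 e2.
  by rewrite -{2}e2 /tgt /= e1 jrow_shift.
have sa := smooth_dtot sv.
have sqv := smooth_at_pair sq sv; have sva := smooth_at_pair sv sa.
have := chain_linear (smooth_at_pair sqv sva)
  (smooth_at_tgt _ (smooth_at_tgt _ sh)) (jrow_lincont 2) hy2.
have ds : \forall Y \near Y0, [/\ differentiable Fq Y, differentiable Fv Y &
    differentiable (dtot Fv) Y].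
  by apply: filterS3 (smooth_at_near sq) (smooth_at_near sv) (smooth_at_near sa)
    => Y /smooth_at_diff ? /smooth_at_diff ? /smooth_at_diff.
apply: filterS2 ds => Y [dq dv da] e X.
by rewrite -e !derive_pair//; exact: differentiable_pair.
Qed.

Lemma indep_q_step k j : (2 < k)%N ->
  (forall k', (k < k')%N -> indep_of Fq Y0 k' j) -> indep_of Fq Y0 k j.
Proof.
move=> k2 hk; apply: contrapT => nflat.
(* Otherwise r^j < k + 2 and [indep_q_top] already excludes y^j_[k]. So rows k + 1 and k + 2 exist,
   and the shifts below are genuine. *)
have kN : (k.+2 < N)%N.
  rewrite ltnNge; apply/negP => Nk; apply: nflat.
  by apply: (indep_q_top rN fq fv sq qv); exact: leq_trans (rN j) Nk.
have k1N := ltnW kN; have k0N := ltnW k1N.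
have q1 := hk k.+1 (ltnSn k); have q2 := hk k.+2 (ltnW (ltnSn k.+1)).
have v2 := indep_v sq qv kN q1 q2.
apply: nflat.
(* [v1] and [u2] follow one coefficient from order k in q through order k + 1 in v to order k + 2 in
   the acceleration, where it is a value of df/du. *)
have v1 := derive_v_eq sq qv k1N q1.
have u2 := derive_a_eq sq sv su sf vf kN q2 v2.
have loc : \forall Y \near Y0, forall e, exists d, 'D_d h (Fq Y) = e.
  exact: (near_preimage (P := fun q => forall e, exists d, 'D_d h q = e)
    (smooth_at_cont sq) hsurj).
have dh : \forall Y \near Y0, smooth_at (Fq Y) h.
  exact: (near_preimage (P := fun q => smooth_at q h)
    (smooth_at_cont sq) (smooth_at_near sh)).
have sK := smooth_at_pair (smooth_at_pair sq sv) su.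
have df : \forall Y \near Y0, smooth_at (Fq Y, Fv Y, Fu Y) f.
  exact: (near_preimage (P := fun z => smooth_at z f)
    (smooth_at_cont sK) (smooth_at_near sf)).
have dqv : \forall Y \near Y0, differentiable Fq Y /\ differentiable Fv Y.
  by apply: filterS2 (smooth_at_near sq) (smooth_at_near sv)
    => Y /smooth_at_diff ? /smooth_at_diff.
have A1 : \forall Y \near Y0, [/\ forall e, exists d, 'D_d h (Fq Y) = e,
   smooth_at (Fq Y) h & smooth_at (Fq Y, Fv Y, Fu Y) f] by apply: filterS3 loc dh df.
have A2 := near_and (near_and output_eq0 output_eq1) output_eq2.
have A3 := near_and (near_and v1 u2) (near_and q1 (derive_f_along sq sv su sf vf)).
apply: filterS3 A1 A2 (near_and A3 dqv) => Y
  [surj shY sfY] [[e0 e1] e2] [[[v1Y u2Y] [q1Y fY]] [dq dv]].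
have dhY := smooth_at_diff shY; have dfY := smooth_at_diff sfY.
(* From here on Y is a fixed nearby jet, and the contradiction is linear algebra at Y. *)
apply/eqP/negPn/negP => T0.
set T := 'D_(yd k j) Fq Y in T0 v1Y u2Y *.
have hT : 'D_T h (Fq Y) = 0.
  by rewrite e0 jrow_yd_ne//; lia.
have line x : 'D_x h (Fq Y) = 0 -> exists a, x = a *: T.
  by apply: (ker_line (lincont_derive_dir dhY).1) => //.
pose B w := 'D_(0, 0, w) f (Fq Y, Fv Y, Fu Y).
have lB : linear B := (lincont_comp (lincont_inr _ _) (lincont_derive_dir dfY)).1.
have BT : exists w, B w = T by exists ('D_(yd k.+2 j) Fu Y); rewrite /B u2Y v1Y.
have Bi i : exists w, 'D_(B w) h (Fq Y) = delta_mx 0 i.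
  have r2 : 'D_('D_(yd 2 i) Fq Y) h (Fq Y) = 0.
    by rewrite e0 jrow_yd_ne.
  have [a aE] := line _ r2.
  pose X1 := yd 2 i - a *: yd k j.
  have X1q : 'D_X1 Fq Y = 0 by rewrite /X1 deriveDirB// deriveDirZ// aE subrr.
  have r1 : 'D_('D_X1 Fv Y) h (Fq Y) = 0.
    have -> := etrans (esym (derive_tgt2 (Fv Y) _ dhY X1q)) (e1 X1).
    rewrite /X1 (lincontB _ _ (jrow_lincont _)) (lincontZ _ _ (jrow_lincont _)).
    rewrite (jrow_yd_ne (k := 1) (k' := 2))// (jrow_yd_ne (k := 1) (k' := k)); last by lia.
    by rewrite scaler0 subrr.
  have [b bE] := line _ r1.
  pose X := X1 - b *: yd k.+1 j.
  have Xq : 'D_X Fq Y = 0.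
    by rewrite /X deriveDirB// deriveDirZ// X1q q1Y scaler0 subrr.
  have Xv : 'D_X Fv Y = 0.
    by rewrite /X deriveDirB// deriveDirZ// bE v1Y subrr.
  exists ('D_X Fu Y).
  have -> : B ('D_X Fu Y) = 'D_X (dtot Fv) Y by rewrite -fY Xq Xv.
  (* As X leaves q and v stationary, both levels of the tangent map reduce to their linear parts,
     and [output_eq2] becomes: dh applied to X vdot is row 2 of X. *)
  have dth := smooth_at_diff (smooth_at_tgt (Fv Y) shY).
  have Xqv : ('D_X Fq Y, 'D_X Fv Y) = 0 by rewrite Xq Xv.
  have -> := etrans (esym (derive_tgt2 (Fv Y) _ dhY Xv))
    (etrans (esym (derive_tgt2 (Fv Y, dtot Fv Y) _ dth Xqv)) (e2 X)).
  (* Here k > 2 is decisive: the corrections of orders k and k + 1 do not touch row 2, which stays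
     equal to e_i. *)
  rewrite /X /X1 !(lincontB _ _ (jrow_lincont _)) !(lincontZ _ _ (jrow_lincont _)).
  rewrite (jrow_yd_ne (k := 2) (k' := k)); last by lia.
  rewrite (jrow_yd_ne (k := 2) (k' := k.+1)); last by lia.
  by rewrite jrow_yd ?eqxx ?scale1r ?scaler0 ?subr0//; lia.
(* Subtracting from w the combination of the [B (c i)] with the same image under dh leaves an
   element of ker dh, hence a multiple of T, which is also a value of B. *)
apply: (not_surj_row lB) => w.
have [c cE] := choice Bi; have [t tE] := BT.
have [B' BE] := lin_pack lB.
have lD := lincont_derive_dir dhY.
have : 'D_(w - \sum_i 'D_w h (Fq Y) 0 i *: B (c i)) h (Fq Y) = 0.
  rewrite (lincontB _ _ lD) (lincont_sum _ lD) {1}(row_sum_delta ('D_w h (Fq Y))).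
  rewrite -sumrB big1// => i _; rewrite (lincontZ _ _ lD) cE subrr//.
move=> /line[a /eqP]; rewrite subr_eq => /eqP ->.
exists (a *: t + \sum_i 'D_w h (Fq Y) 0 i *: c i).
rewrite BE linearD linearZ linear_sum -BE tE; congr (_ + _).
by apply: eq_bigr => i _; rewrite BE linearZ.
Qed.

(** Descending induction on k, started at k >= N, where there is no coordinate left. *)
Lemma indep_q_high k j : (2 < k)%N -> indep_of Fq Y0 k j.
Proof.
move=> k2; have [n] := ubnP (N - k); elim: n k k2 => // n IH k k2 nk.
have [kN|Nk] := ltnP k N; last exact: indep_out.
apply: indep_q_step => // k' kk'; have [k'N|Nk'] := ltnP k' N; last exact: indep_out.
by apply: IH; lia.
Qed.

(** With r^j < 2 not even y^j itself would enter Fq, against h (Fq) = y. *)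
Lemma order_ge2 j : (0 < N)%N -> (2 <= r j)%N.
Proof.
move=> N0; rewrite leqNgt; apply/negP => rj.
have fl := indep_q_top rN fq fv sq qv (rj : (r j < 0.+2)%N).
have /filter_ex[Y [z e]] := near_and fl output_eq0.
have := e (yd 0 j); rewrite z derive0 jrow_yd// eqxx scale1r => /rowP/(_ j).
by rewrite !mxE !eqxx => /esym/eqP; rewrite oner_eq0.
Qed.

(** Orders 0 and 1 are absent from X and orders above 2 from Fq, so only order 2 can produce the
    nonzero derivative. *)
Lemma exists_depends_q X : jrow 0 X = 0 -> jrow 1 X = 0 -> 'D_X Fq Y0 != 0 ->
  exists j, ~ indep_of Fq Y0 2 j.
Proof.
move=> X0 X1 nz; apply: contrapT => nex.
have all2 j : indep_of Fq Y0 2 j.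
  by apply: contrapT => n; apply: nex; exists j.
move/eqP: nz; apply; rewrite derive_sum_yd; last exact: smooth_at_diff.
rewrite big1// => k _; rewrite big1// => j _; rewrite -jrow_ord.
have fl (k' : nat) : (1 < k')%N -> 'D_(yd k' j) Fq Y0 = 0.
  move=> k1; have : indep_of Fq Y0 k' j.
    by case: k' k1 => [|[|[|k']]]// _; exact: indep_q_high.
  by move/nbhs_singleton.
case E : (nat_of_ord k) => [|[|k']].
- by rewrite X0 mxE scale0r.
- by rewrite X1 mxE scale0r.
- by rewrite -E fl ?scaler0// E.
Qed.
End ConfigurationOutput.

(** * Polynomial differential operators *)

Section DifferentialOperators.
Context {R : fieldType}.
Implicit Types (p q : {poly R}) (s : nat -> R).

(* The operator p(d/dt) on the jet s of a function of time. *)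
Definition pact p s (n : nat) : R := \sum_(i < size p) p`_i * s (i + n)%N.

Lemma pact_wide k p s n : (size p <= k)%N ->
  pact p s n = \sum_(i < k) p`_i * s (i + n)%N.
Proof.
move=> pk; rewrite /pact (big_ord_widen _ (fun i => p`_i * s (i + n)%N) pk).
rewrite big_mkcond; apply: eq_bigr => i _; case: ifP => // /negbT.
by rewrite -leqNgt => /(nth_default 0) ->; rewrite mul0r.
Qed.

Lemma pact0 s n : pact 0 s n = 0.
Proof. by rewrite /pact size_poly0 big_ord0. Qed.

Lemma pactD p q s n : pact (p + q) s n = pact p s n + pact q s n.
Proof.
pose k := maxn (size p) (size q).
rewrite !(pact_wide (k := k)) ?leq_maxl ?leq_maxr ?size_polyD// -big_split.
by apply: eq_bigr => i _; rewrite coefD mulrDl.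
Qed.

Lemma pactZ c p s n : pact (c *: p) s n = c * pact p s n.
Proof.
rewrite !(pact_wide (k := size p)) ?size_scale_leq// mulr_sumr.
by apply: eq_bigr => i _; rewrite coefZ mulrA.
Qed.

Lemma pactMX p s n : pact (p * 'X) s n = pact p s n.+1.
Proof.
rewrite (pact_wide (k := (size p).+1)); last first.
  by rewrite (leq_trans (size_polyMleq _ _))// size_polyX addn2.
rewrite big_ord_recl coefMX eqxx mul0r add0r; apply: eq_bigr => i _.
by rewrite coefMX /= addSnnS.
Qed.

Lemma pactM p q s n : pact (p * q) s n = pact p (pact q s) n.
Proof.
elim/poly_ind: p n => [|p c IH] n; first by rewrite mul0r !pact0.
rewrite mulrDl mul_polyC !pactD -mulrA (mulrC 'X) mulrA !pactMX IH pactZ.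
congr (_ + _); rewrite -[c%:P]mulr1 mul_polyC pactZ.
by rewrite /pact size_poly1 big_ord1 coef1 mul1r.
Qed.

Lemma pact_sum (I : finType) (P : I -> {poly R}) s n :
  pact (\sum_i P i) s n = \sum_i pact (P i) s n.
Proof. by apply: (big_morph (fun p => pact p s n)) => [p q|]; rewrite ?pactD ?pact0. Qed.

Lemma pact_sumr (I : finType) p (s : I -> nat -> R) n :
  pact p (fun k => \sum_i s i k) n = \sum_i pact p (s i) n.
Proof. by rewrite /pact exchange_big; apply: eq_bigr => i _; rewrite mulr_sumr. Qed.

Lemma eq_pact p s s' n : s =1 s' -> pact p s n = pact p s' n.
Proof. by move=> ss; apply: eq_bigr => i _; rewrite ss. Qed.

(* If C(d/dt) y = 0 and u = P(d/dt) y with u arbitrary, then every polynomial w with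
   P w = g C satisfies w(d/dt) u = 0, hence w = 0.  Taking g = 0 gives det P <> 0,
   and w = adj(P) C then gives C = 0. *)
Lemma no_output_relation (m K N : nat) (P : nat -> 'M[R]_m) (C : 'M[R]_(N, m))
    (S : (nat -> 'rV[R]_m) -> (nat -> 'rV[R]_m) -> Prop) :
  (forall u, exists y, S y u) ->
  (forall y u a, S y u -> u a = \sum_(k < K) y (k + a)%N *m P k) ->
  (forall y u a, S y u -> \sum_(k < N) \sum_j y (k + a)%N 0 j * C k j = 0) ->
  C = 0.
Proof.
move=> full yu yC.
(* P and C with entries polynomial in d/dt. Jets are rows, so u^j is the sum over i of [Ph i j]
   applied to y^i, and relations among the u^j correspond to columns w. *)
pose Ph : 'M[{poly R}]_m := \matrix_(i, j) \poly_(k < K) P k i j.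
pose Ch : 'cV[{poly R}]_m :=
  \col_i \poly_(k < N) (if insub k is Some k' then C k' i else 0).
have uE y u j a : S y u -> u a 0 j = \sum_i pact (Ph i j) (fun n => y n 0 i) a.
  move=> /(yu _ _ a) ->; rewrite summxE; under eq_bigr do rewrite mxE.
  rewrite exchange_big; apply: eq_bigr => i _ /=.
  rewrite (pact_wide (k := K)); last by rewrite mxE size_poly.
  by apply: eq_bigr => k _; rewrite mxE coef_poly ltn_ord mulrC.
have CE y u a : S y u -> \sum_i pact (Ch i 0) (fun n => y n 0 i) a = 0.
  move=> /(yC _ _ a) e; rewrite -[RHS]e exchange_big; apply: eq_bigr => i _ /=.
  rewrite (pact_wide (k := N)); last by rewrite mxE size_poly.
  by apply: eq_bigr => k _; rewrite mxE coef_poly ltn_ord valK mulrC.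
have w0 (w : 'cV[{poly R}]_m) g : Ph *m w = g *: Ch -> w = 0.
  move=> Pw; have rel y u : S y u -> \sum_j pact (w j 0) (fun n => u n 0 j) 0 = 0.
    move=> Syu.
    transitivity (\sum_j \sum_i pact (Ph i j * w j 0) (fun n => y n 0 i) 0).
      apply: eq_bigr => j _; rewrite (eq_pact _ _ (fun n => uE y u j n Syu)).
      by rewrite pact_sumr; apply: eq_bigr => i _; rewrite mulrC pactM.
    rewrite exchange_big; transitivity (\sum_i pact (g * Ch i 0) (fun n => y n 0 i) 0).
      apply: eq_bigr => i _; rewrite -pact_sum; congr pact.
      by have /matrixP/(_ i 0) := Pw; rewrite !mxE.
    under eq_bigr do rewrite pactM.
    rewrite -pact_sumr (eq_pact _ _ (fun n => CE y u n Syu)) /pact big1// => k _.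
    by rewrite mulr0.
  apply/matrixP => j z; rewrite ord1 mxE; apply/polyP => b; rewrite coef0.
  (* An input jet whose only nonzero entry is a 1 in component j at order b makes the relation read
     off the coefficient of degree b of w_j. *)
  have [y Sy] := full (fun n => (n == b)%:R *: delta_mx 0 j).
  rewrite -[RHS](rel _ _ Sy) (bigD1 j)//= [X in _ + X]big1 ?addr0; last first.
    move=> i ij; rewrite /pact big1// => k _; rewrite !mxE (negPf ij) andbF.
    by rewrite !mulr0.
  rewrite /pact; have [sb|bs] := leqP (size (w j 0)) b.
    rewrite nth_default// big1// => k _; rewrite !mxE addn0.
    have /negPf-> : k != b :> nat by rewrite neq_ltn (leq_trans (ltn_ord k) sb).
    by rewrite mul0r mulr0.
  rewrite (bigD1 (Ordinal bs))//= big1 ?addr0; last first.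
    move=> k kb; rewrite !mxE addn0.
    have /negPf-> : k != b :> nat by rewrite -val_eqE in kb.
    by rewrite mul0r mulr0.
  by rewrite !mxE addn0 !eqxx !mulr1.
have detP : \det Ph != 0.
  rewrite -det_tr; apply/negP => /det0P[v v0 vP].
  have /w0/eqP : Ph *m v^T = 0 *: Ch.
    by apply: trmx_inj; rewrite trmx_mul trmxK vP scale0r trmx0.
  by rewrite -trmx0 (inj_eq trmx_inj) (negPf v0).
have /w0 adjC : Ph *m (\adj Ph *m Ch) = \det Ph *: Ch.
  by rewrite mulmxA mul_mx_adj mul_scalar_mx.
have /eqP : \det Ph *: Ch = 0.
  by rewrite -mul_scalar_mx -mul_mx_adj -mulmxA adjC mulmx0.
rewrite scalemx_eq0 (negPf detP) => /eqP Ch0.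
apply/matrixP => k i; rewrite mxE.
have /matrixP/(_ i 0) := Ch0; rewrite !mxE => /polyP/(_ k).
by rewrite coef_poly ltn_ord valK coef0.
Qed.
End DifferentialOperators.

(** * Jets of the system *)

Section SystemJets.
Context {R : realType} {S : normedModType R} {m : nat}.
Context (finS : fincoord S).
Local Notation J := (jet S m).
Local Notation FJ := (@fjet R S m).

Lemma fincoord_fjet L : fincoord (FJ L).
Proof. by apply: fincoord_prod => //; exact: fincoord_mx. Qed.

Lemma lincont_fjet L (W : normedModType R) (f : FJ L -> W) : linear f -> lincont f.
Proof. exact/fincoord_lincont/fincoord_fjet. Qed.

(** A section of [trunc L]: the derivatives of u from order L on are set to 0. *)
Definition ext_jet L (w : FJ L) : J := (w.1, fun a => jrow a w.2).
Definition proj_jet L l (w : FJ L) : FJ l := trunc l (ext_jet w).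

Lemma trunc_ext_jet L (w : FJ L) : trunc L (ext_jet w) = w.
Proof.
case: w => x U; congr pair; apply/matrixP => a j.
by rewrite mxE jrow_ord.
Qed.

Lemma proj_jet_trunc l L (z : J) : (l <= L)%N -> proj_jet l (trunc L z) = trunc l z.
Proof.
move=> lL; congr pair; apply/matrixP => a j; rewrite !mxE.
have aL : (a < L)%N := leq_trans (ltn_ord a) lL.
by rewrite (insubT (fun i => (i < L)%N) aL) mxE.
Qed.

Lemma proj_jet_lincont L l : lincont (@proj_jet L l).
Proof.
apply: lincont_fjet => a u v; congr pair; apply/matrixP => i j; rewrite !mxE /=.
by case: insub => [b|]; rewrite ?mxE//= mulr0 addr0.
Qed.

Lemma input_lincont L : lincont (fun w : FJ L => jrow 0 w.2).
Proof. exact: (lincont_comp (lincont_snd _ _) (jrow_lincont 0)). Qed.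

(** Projection from a longer truncation to a shorter one is continuous, so further coordinates may
    be carried along and several conditions can share one L. *)
Lemma near_jet_ge (z0 : J) (P : J -> Prop) : near_jet z0 P ->
  exists L0, forall L, (L0 <= L)%N ->
    \forall w \near trunc L z0, forall z, trunc L z = w -> P z.
Proof.
move=> [L0 h]; exists L0 => L L0L.
have h' : \forall w \near proj_jet L0 (trunc L z0), forall z, trunc L0 z = w -> P z.
  by rewrite proj_jet_trunc.
apply: filterS (near_preimage (P := fun w => forall z, trunc L0 z = w -> P z)
  ((proj_jet_lincont L L0).2 _) h') => w hw z zw.
by apply: hw; rewrite -zw proj_jet_trunc.
Qed.

Lemma near_jet_ext (z0 : J) (P : J -> Prop) : near_jet z0 P ->
  exists L0, forall L, (L0 <= L)%N -> \forall w \near trunc L z0, P (ext_jet w).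
Proof.
move=> /near_jet_ge[L0 h]; exists L0 => L /h; apply: filterS => w; apply.
exact: trunc_ext_jet.
Qed.

Lemma near_jet_and (z0 : J) (P Q : J -> Prop) :
  near_jet z0 P -> near_jet z0 Q -> near_jet z0 (fun z => P z /\ Q z).
Proof.
move=> /near_jet_ge[L1 h1] /near_jet_ge[L2 h2]; exists (maxn L1 L2).
apply: filterS2 (h1 _ (leq_maxl _ _)) (h2 _ (leq_maxr _ _)) => w H1 H2 z zw.
by split; [exact: H1|exact: H2].
Qed.

Lemma near_jet_imp (z0 : J) (P Q : J -> Prop) : (forall z, P z -> Q z) ->
  near_jet z0 P -> near_jet z0 Q.
Proof. by move=> PQ [L h]; exists L; apply: filterS h => w H z /H/PQ. Qed.

Lemma near_jet_center (z0 : J) (P : J -> Prop) : near_jet z0 P -> P z0.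
Proof. by move=> [L /nbhs_singleton]; apply. Qed.

Context (F : S * 'rV[R]_m -> S) (xs : S) (us : 'rV[R]_m).
Context (sF : smooth_at (xs, us) F) (F0 : F (xs, us) = 0).
Let z0 : J := const_jet xs us.

Definition flow (z : J) : J := (F (z.1, z.2 0%N), fun a => z.2 a.+1).
(** The linearisation at the equilibrium jet of the prolonged vector field [flow]; it plays the part
    of d/dt on perturbations. *)
Definition flow_lin (d : J) : J := ('D_(d.1, d.2 0%N) F (xs, us), fun a => d.2 a.+1).

Definition init_jet l (w : FJ l.+1) : FJ l := (w.1, row' ord_max w.2).

Lemma init_jet_lincont l : lincont (@init_jet l).
Proof.
apply: lincont_fjet => a u v; congr pair; apply/matrixP => i j.
by rewrite !mxE.
Qed.

Lemma init_jet_trunc l z : init_jet (trunc l.+1 z) = trunc l z.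
Proof.
by congr pair; apply/matrixP => i j; rewrite !mxE lift_max.
Qed.

Lemma Dt_trunc (W : normedModType R) l (g : FJ l -> W) z :
  Dt F g (trunc l.+1 z) = 'D_(trunc l (flow z)) g (trunc l z).
Proof.
apply: (f_equal2 (derive g)); first exact: init_jet_trunc.
congr pair; last by apply/matrixP => i j; rewrite !mxE lift0.
by apply: (congr1 F); congr pair; apply/rowP => j; rewrite !mxE.
Qed.

(** The field along which [Dt] differentiates vanishes at the equilibrium jet, so the term with
    second derivatives of g drops out and only the linearised field remains. *)
Lemma smooth_Dt (W : normedModType R) l (g : FJ l -> W) :
  smooth_at (trunc l z0) g ->
  smooth_at (trunc l.+1 z0) (Dt F g) /\
  forall d, 'D_(trunc l.+1 d) (Dt F g) (trunc l.+1 z0) =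
            'D_(trunc l (flow_lin d)) g (trunc l z0).
Proof.
move=> sg.
pose e (w : FJ l.+1) := (w.1, row ord0 w.2).
have le : lincont e.
  apply: lincont_fjet => a u v; congr pair; apply/matrixP => i j.
  by rewrite !mxE.
have ez0 : e (trunc l.+1 z0) = (xs, us).
  by congr pair; apply/matrixP => i j; rewrite !mxE ord1.
pose b (w : FJ l.+1) := row' ord0 w.2.
have lb : lincont b.
  apply: lincont_fjet => a u v; apply/matrixP => i j.
  by rewrite !mxE.
have bz0 : b (trunc l.+1 z0) = 0.
  by apply/matrixP => i j; rewrite !mxE.
have sF' : smooth_at (e (trunc l.+1 z0)) F by rewrite ez0.
have sFe : smooth_at (trunc l.+1 z0) (F \o e).
  by apply: smooth_at_comp sF'; exact: smooth_at_lin.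
have sb := smooth_at_lin (trunc l.+1 z0) lb.
pose K w := (init_jet w, ((F \o e) w, b w)).
have sf : smooth_at (trunc l.+1 z0) (fun w => ((F \o e) w, b w)).
  exact: smooth_at_pair.
have sK : smooth_at (trunc l.+1 z0) K.
  by apply: smooth_at_pair => //; exact/smooth_at_lin/init_jet_lincont.
have Kz0 : K (trunc l.+1 z0) = (trunc l z0, 0).
  by rewrite /K init_jet_trunc /= ez0 F0 bz0.
have st : smooth_at (K (trunc l.+1 z0)) (tgt g) by rewrite Kz0; exact: smooth_at_tgt.
have DE : Dt F g = tgt g \o K by [].
split=> [|d]; first by rewrite DE; exact: smooth_at_comp.
rewrite DE (derive_comp _ (smooth_at_diff sK) (smooth_at_diff st)) Kz0.
rewrite (derive_pair _ (lincont_diff _ (init_jet_lincont l)) (smooth_at_diff sf)).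
rewrite (derive_pair _ (smooth_at_diff sFe) (smooth_at_diff sb)).
rewrite derive_tgt//.
have -> : 'D_0 g = cst 0 by apply/funext => y; rewrite derive0.
rewrite derive_cst add0r; apply: (congr1 (derive g (trunc l z0))); congr pair.
  rewrite (derive_linl _ _ _ le) ez0; apply: (congr1 (derive F (xs, us))).
  by congr pair; apply/matrixP => i j; rewrite !mxE ord1.
by rewrite (lincont_derive _ _ lb); apply/matrixP => i j; rewrite !mxE.
Qed.
End SystemJets.

Lemma smooth_at_sum (R : realType) (V W : normedModType R) (x : V) (I : finType)
    (f : I -> V -> W) : (forall i, smooth_at x (f i)) ->
  smooth_at x (fun y => \sum_i f i y).
Proof.
move=> sf; elim: (index_enum I) => [|i s IH].
  apply: smooth_at_eq (smooth_at_cst x 0); apply: near_always => y.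
  by rewrite big_nil.
have : smooth_at x ((fun z : W * W => z.1 + z.2) \o
    (fun y => (f i y, \sum_(j <- s) f j y))).
  apply: smooth_at_comp (smooth_at_lin _ (lincont_add W)).
  exact: smooth_at_pair.
by apply: smooth_at_eq; apply: near_always => y; rewrite big_cons.
Qed.

Lemma smooth_at_rows (R : realType) (V : normedModType R) N m (x : V)
    (f : V -> 'M[R]_(N, m)) : (forall k, smooth_at x (fun y => row k (f y))) ->
  smooth_at x f.
Proof.
move=> sf; pose E (k : 'I_N) (u : 'rV[R]_m) : 'M[R]_(N, m) :=
  \matrix_(i, j) ((i == k)%:R * u 0 j).
have lE k : lincont (E k).
  apply: fincoord_lincont; first exact: fincoord_mx.
  by move=> a u v; apply/matrixP => i j; rewrite !mxE mulrDr mulrCA.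
have : smooth_at x (fun y => \sum_k (E k \o (fun y => row k (f y))) y).
  apply: smooth_at_sum => k; apply: smooth_at_comp (sf k) _.
  exact: smooth_at_lin.
apply: smooth_at_eq; apply: near_always => y; apply/matrixP => i j.
rewrite summxE (bigD1 i)//= big1 ?addr0 => [|k ki].
  by rewrite !mxE eqxx mul1r.
by rewrite !mxE eq_sym (negPf ki) mul0r.
Qed.

(** * The output jet as an open map *)

Section FlatOutput.
Context {R : realType} {S : normedModType R} {m : nat}.
Context (finS : fincoord S).
Local Notation J := (jet S m).
Local Notation FJ := (@fjet R S m).
Context (F : S * 'rV[R]_m -> S) (xs : S) (us : 'rV[R]_m).
Context (sF : smooth_at (xs, us) F) (F0 : F (xs, us) = 0).
Local Notation z0 := (const_jet xs us).
Context (l : nat) (phi : FJ l -> 'rV[R]_m).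
Context (sphi : smooth_at (trunc l z0) phi).
Local Notation td := (fun k => @tder R S m F _ l k phi).

Lemma smooth_tder k : smooth_at (trunc (k + l) z0) (td k).
Proof.
by elim: k => [|k IH] //; exact: (smooth_Dt finS sF F0 IH).1.
Qed.

(* d phi_[k] at the equilibrium, applied to the jet d. *)
Definition dphi (d : J) (k : nat) : 'rV[R]_m :=
  'D_(trunc (k + l) d) (td k) (trunc (k + l) z0).

Lemma dphi_flow d k : dphi d k.+1 = dphi (flow_lin F xs us d) k.
Proof. exact: (smooth_Dt finS sF F0 (smooth_tder k)).2. Qed.

(** The output jet as a map between normed spaces, so that it can be differentiated; for N + l <= L
    the padding by zeros has no influence. *)
Definition yfin N L (w : FJ L) : 'M[R]_(N, m) := yjet F phi N (ext_jet w).

Lemma yfin_trunc N L z : (N + l <= L)%N -> yfin N (trunc L z) = yjet F phi N z.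
Proof.
move=> NL; apply/matrixP => k j; rewrite !mxE -/(proj_jet (k + l) (trunc L z)).
by rewrite proj_jet_trunc// (leq_trans _ NL)// leq_add2r ltnW.
Qed.

Lemma row_yfin N L (k : 'I_N) :
  (fun w : FJ L => row k (yfin N w)) = td k \o @proj_jet R S m L (k + l).
Proof. by apply/funext => w; apply/rowP => j; rewrite !mxE. Qed.

Lemma smooth_yfin N L : (N + l <= L)%N -> smooth_at (trunc L z0) (@yfin N L).
Proof.
move=> NL; apply: smooth_at_rows => k; rewrite row_yfin.
apply: smooth_at_comp; first exact/smooth_at_lin/proj_jet_lincont.
rewrite proj_jet_trunc; first exact: smooth_tder.
by rewrite (leq_trans _ NL)// leq_add2r ltnW.
Qed.

Lemma row_derive_yfin N L (w d : FJ L) (k : 'I_N) : smooth_at w (@yfin N L) ->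
  row k ('D_d (@yfin N L) w) = 'D_(proj_jet (k + l) d) (td k) (proj_jet (k + l) w).
Proof.
move=> sy; have lr : lincont (row k : 'M[R]_(N, m) -> 'rV[R]_m).
  apply: fincoord_lincont; first exact: fincoord_mx.
  by move=> a u v; rewrite linearP.
rewrite -(derive_linr _ lr (smooth_at_diff sy)).
rewrite (_ : row k \o @yfin N L = td k \o @proj_jet R S m L (k + l)); last exact: row_yfin.
by rewrite (derive_linl _ _ _ (proj_jet_lincont finS _ _)).
Qed.

Lemma row_derive_yfin0 N L d (k : 'I_N) : (N + l <= L)%N ->
  row k ('D_(trunc L d) (@yfin N L) (trunc L z0)) = dphi d k.
Proof.
move=> NL; have kL : (k + l <= L)%N by rewrite (leq_trans _ NL)// leq_add2r ltnW.
by rewrite (row_derive_yfin _ _ (smooth_yfin NL)) !proj_jet_trunc.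
Qed.

Context (r : 'I_m -> nat) (Fx : 'M[R]_(nrows r, m) -> S)
  (Fu : 'M[R]_(nrows r, m) -> 'rV[R]_m).
Local Notation N := (nrows r).
Local Notation Y0 := (yjet F phi N z0).
Context (fx : function_of r 1 Fx)
  (sx : smooth_at Y0 Fx) (su : smooth_at Y0 Fu)
  (param : near_jet z0 (fun z =>
     z.1 = Fx (yjet F phi N z) /\ z.2 0%N = Fu (yjet F phi N z))).

Lemma param_ext : exists L0, forall L, (L0 <= L)%N -> [/\ (N + l <= L)%N, (0 < L)%N &
  \forall w \near trunc L z0, w.1 = Fx (yfin N w) /\ jrow 0 w.2 = Fu (yfin N w)].
Proof.
have [L0 h] := near_jet_ext finS param; exists (L0 + (N + l)).+1 => L L0L.
by split; [lia|lia|apply: h; lia].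
Qed.

Lemma param_derive : exists L0, forall L, (L0 <= L)%N -> [/\ (N + l <= L)%N &
  forall d : J,
    d.1 = 'D_('D_(trunc L d) (@yfin N L) (trunc L z0)) Fx Y0 /\
    d.2 0%N = 'D_('D_(trunc L d) (@yfin N L) (trunc L z0)) Fu Y0].
Proof.
have [L0 h] := param_ext; exists L0 => L /h[NL L0' e]; split=> // d.
have sy := smooth_yfin NL; have yE := yfin_trunc z0 NL.
have sx' : smooth_at (yfin N (trunc L z0)) Fx by rewrite yE.
have su' : smooth_at (yfin N (trunc L z0)) Fu by rewrite yE.
have ex : \forall w \near trunc L z0, w.1 = (Fx \o @yfin N L) w.
  by apply: filterS e => w [].
have eu : \forall w \near trunc L z0, jrow 0 w.2 = (Fu \o @yfin N L) w.
  by apply: filterS e => w [].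
split.
  apply: etrans (etrans (near_eq_derive (trunc L d) ex) _).
    by rewrite (lincont_derive _ _ (lincont_fst _ _)).
  by rewrite (derive_comp _ (smooth_at_diff sy) (smooth_at_diff sx')) yE.
apply: etrans (etrans (near_eq_derive (trunc L d) eu) _).
  rewrite (lincont_derive _ _ (@input_lincont R S m L)).
  by apply/rowP => j; rewrite (jrow_ord (Ordinal L0')) mxE.
by rewrite (derive_comp _ (smooth_at_diff sy) (smooth_at_diff su')) yE.
Qed.

Lemma dphi_iter d k a : dphi (iter a (flow_lin F xs us) d) k = dphi d (k + a).
Proof.
by elim: a k => [|a IH] k; [rewrite addn0|rewrite iterS -dphi_flow IH addnS].
Qed.

Lemma iter_flow_lin d a b : (iter a (flow_lin F xs us) d).2 b = d.2 (a + b)%N.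
Proof. by elim: a b => [|a IH] b //; rewrite iterS /= IH addnS. Qed.

(** The linearised parameterization gives the case a = 0; applied to the perturbation shifted a
    times it gives every order. The derivatives of Fu are the coefficients of P in u = P(d/dt)
    dy. *)
Lemma input_dphi d a : d.2 a = \sum_(k < N)
  dphi d (k + a) *m \matrix_(i, j) 'D_(y_dir N k i) Fu Y0 0 j.
Proof.
rewrite -[a in LHS]addn0 -iter_flow_lin; have [L h] := param_derive.
have [NL /(_ (iter a (flow_lin F xs us) d))[_ ->]] := h _ (leqnn L).
rewrite derive_sum_yd; last exact: smooth_at_diff.
apply: eq_bigr => k _; rewrite -dphi_iter -(row_derive_yfin0 _ k NL).
apply/rowP => j; rewrite summxE mxE; apply: eq_bigr => i _.
by rewrite !mxE.
Qed.

Lemma yfin_surj L : (N + l <= L)%N ->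
  exists i : 'M[R]_(N, m) -> FJ L, lincont i /\
    forall w, 'D_(i w) (@yfin N L) (trunc L z0) = w.
Proof.
move=> NL; have sy := smooth_yfin NL.
apply: (lin_surj (fincoord_fjet finS L) (lincont_derive_dir (smooth_at_diff sy)).1) => C hC.
apply: (@no_output_relation _ m N N
  (fun k => \matrix_(i, j) 'D_(y_dir N k i) Fu Y0 0 j) C
  (fun y u => exists2 d : J, y = dphi d & u = d.2)).
(* Perturbations with zero state part already realise every input jet. *)
- by move=> u; exists (dphi (0, u)), (0, u).
- by move=> _ _ a [d -> ->]; exact: input_dphi.
- move=> _ _ a [d -> _]; rewrite -[RHS](hC (trunc L (iter a (flow_lin F xs us) d))).
  apply: eq_bigr => k _; apply: eq_bigr => j _; congr (_ * _).
  by rewrite -dphi_iter -(row_derive_yfin0 _ k NL) mxE.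
Qed.

Lemma yfin_open L (A : set (FJ L)) : (N + l <= L)%N -> nbhs (trunc L z0) A ->
  \forall Y \near Y0, exists2 w, A w & yfin N w = Y.
Proof.
move=> NL nA; have [i [li iE]] := yfin_surj NL.
by rewrite -(yfin_trunc z0 NL); exact: open_mapping (smooth_yfin NL) li iE nA.
Qed.

Lemma row_flow_yfin L (w : FJ L) (k : 'I_N) j : (N + l <= L)%N ->
  smooth_at w (@yfin N L) -> (k.+1 < N)%N ->
  'D_(trunc L (flow F (ext_jet w))) (@yfin N L) w k j = shift_rows (yfin N w) k j.
Proof.
move=> NL sy kN; have kL : (k + l <= L)%N by rewrite (leq_trans _ NL)// leq_add2r ltnW.
transitivity (row k ('D_(trunc L (flow F (ext_jet w))) (@yfin N L) w) 0 j).
  by rewrite mxE.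
rewrite (row_derive_yfin _ _ sy) proj_jet_trunc// mxE (jrow_ord (Ordinal kN)) mxE /=.
by rewrite (Dt_trunc F (td k) (ext_jet w)).
Qed.

Lemma dtot_param : \forall Y \near Y0, dtot Fx Y = F (Fx Y, Fu Y).
Proof.
have [L h] := param_ext; have [NL L0 e] := h _ (leqnn L).
have sy := smooth_yfin NL.
have ex : \forall w \near trunc L z0, w.1 = (Fx \o @yfin N L) w.
  by apply: filterS e => w [].
have sfx : \forall w \near trunc L z0, smooth_at (yfin N w) Fx.
  apply: (near_preimage (P := fun Y => smooth_at Y Fx) (smooth_at_cont sy)).
  by rewrite yfin_trunc//; exact: smooth_at_near.
have good : \forall w \near trunc L z0,
    dtot Fx (yfin N w) = F (Fx (yfin N w), Fu (yfin N w)).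
  apply: filterS3 (near_and e sfx) (near_derive ex) (smooth_at_near sy).
  move=> w [[e1 e2] sx'] /(_ (trunc L (flow F (ext_jet w)))).
  move=> + sy'; rewrite (lincont_derive _ _ (lincont_fst _ _)).
  rewrite (derive_comp _ (smooth_at_diff sy') (smooth_at_diff sx')).
  rewrite /= -e1 -e2 => ->; rewrite /dtot.
  (* The two directions may differ in the last row, where [shift_rows] puts 0; Fx does not see that
     row, because k + 1 <= r^j < N. *)
  have ag (k : 'I_N) j : (k + 1 <= r j)%N -> 'D_(trunc L (flow F (ext_jet w))) (@yfin N L) w k j =
      shift_rows (yfin N w) k j.
    move=> kj; apply: row_flow_yfin => //; rewrite ltnS -addn1.
    exact: leq_trans kj (leq_bigmax j).
  by apply/esym/(function_of_dir _ fx) => k j; exact: ag.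
apply: filterS (yfin_open NL good) => Y [w + <-].
exact.
Qed.
End FlatOutput.

Lemma ltn_nrows m (r : 'I_m -> nat) j : (r j < nrows r)%N.
Proof. by rewrite ltnS leq_bigmax. Qed.

Lemma leq_nrows m (r r' : 'I_m -> nat) : (forall j, (r' j <= r j)%N) ->
  (nrows r' <= nrows r)%N.
Proof.
move=> rr; rewrite ltnS; apply/bigmax_leqP => j _.
exact: leq_trans (rr j) (leq_bigmax j).
Qed.

(** * Lowering the multi-index *)

Section Jets.
Context {R : realType} {S : normedModType R} {m : nat}.
Context (finS : fincoord S).
Context (F : S * 'rV[R]_m -> S) (xs : S) (us : 'rV[R]_m).
Context (sF : smooth_at (xs, us) F) (F0 : F (xs, us) = 0).
Local Notation z0 := (const_jet xs us).
Context (l : nat) (phi : @fjet R S m l -> 'rV[R]_m).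
Context (sphi : smooth_at (trunc l z0) phi).

Lemma near_yjet N (P : 'M[R]_(N, m) -> Prop) :
  (\forall Y \near yjet F phi N z0, P Y) ->
  near_jet z0 (fun z => P (yjet F phi N z)).
Proof.
move=> nP; exists (N + l)%N.
have sy := smooth_yfin finS sF F0 sphi (leqnn (N + l)).
have nP' : \forall Y \near yfin F phi N (trunc (N + l) z0), P Y by rewrite yfin_trunc.
apply: filterS (near_preimage (P := P) (smooth_at_cont sy) nP') => w Pw z zw.
by rewrite -(yfin_trunc F phi z (leqnn _)) zw.
Qed.

Lemma admissible_shrink (r r' : 'I_m -> nat) (Fx : 'M[R]_(nrows r, m) -> S)
    (Fu : 'M[R]_(nrows r, m) -> 'rV[R]_m) (Y0 := yjet F phi (nrows r) z0) :
  (forall j, (r' j <= r j)%N) -> smooth_at Y0 Fx -> smooth_at Y0 Fu ->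
  near_jet z0 (fun z => z.1 = Fx (yjet F phi (nrows r) z) /\
                        z.2 0%N = Fu (yjet F phi (nrows r) z)) ->
  (\forall Y \near Y0, Fx Y = Fx (freeze (fun k j => (k + 1 <= r' j)%N) Y0 Y)) ->
  (\forall Y \near Y0, Fu Y = Fu (freeze (fun k j => (k + 0 <= r' j)%N) Y0 Y)) ->
  admissible F phi z0 r'.
Proof.
move=> rr sx su param fx fu; set N := nrows r in Fx Fu Y0 sx su param fx fu *.
set N' := nrows r'.
have NN : (N' <= N)%N := leq_nrows rr.
(* Coordinates dropped in passing from r to r' receive their equilibrium values; c = 1 serves Fx and
   c = 0 serves Fu. *)
pose emb c (Y : 'M[R]_(N', m)) : 'M[R]_(N, m) :=
  \matrix_(k, j) if (k + c <= r' j)%N then jrow k Y 0 j else Y0 k j.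
have embY c z : emb c (yjet F phi N' z) =
    freeze (fun k j => (k + c <= r' j)%N) Y0 (yjet F phi N z).
  apply/matrixP => k j; rewrite !mxE; case: ifP => // kc.
  have kN : (k < N')%N.
    by rewrite (leq_ltn_trans _ (ltn_nrows r' j))// (leq_trans _ kc)// leq_addr.
  by rewrite (insubT (fun i => (i < N')%N) kN) mxE.
have embY0 c : emb c (yjet F phi N' z0) = Y0.
  by rewrite embY; apply/matrixP => k j; rewrite mxE if_same.
have semb c Y : smooth_at Y (emb c).
  pose P (Y : 'M[R]_(N', m)) : 'M[R]_(N, m) :=
    \matrix_(k, j) if (k + c <= r' j)%N then jrow k Y 0 j else 0.
  pose C : 'M[R]_(N, m) := \matrix_(k, j) if (k + c <= r' j)%N then 0 else Y0 k j.
  have lP : lincont P.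
    apply: fincoord_lincont; first exact: fincoord_mx.
    move=> a u v; apply/matrixP => i j; rewrite !mxE.
    case: ifP => [_|_]; last by rewrite mulr0 addr0.
    by case: insub => [b|]; rewrite ?mxE// mulr0 addr0.
  rewrite (_ : emb c = fun Y => P Y + C); first exact: smooth_at_affine.
  apply/funext => Y'; apply/matrixP => i j; rewrite !mxE.
  by case: ifP => _; rewrite ?addr0 ?add0r.
have fun_emb c (W : Type) (H : 'M[R]_(N, m) -> W) : function_of r' c (H \o emb c).
  move=> Y Y' YY; congr H; apply/matrixP => k j; rewrite !mxE; case: ifP => // kc.
  case: insubP => // i _ ik; apply: YY; by rewrite ik.
exists (Fx \o emb 1%N), (Fu \o emb 0%N); split=> //.
- apply/(smooth_nearE _ _ (@fincoord_mx R N' m)).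
  by apply: smooth_at_comp => //; rewrite embY0.
- apply/(smooth_nearE _ _ (@fincoord_mx R N' m)).
  by apply: smooth_at_comp => //; rewrite embY0.
apply: near_jet_imp (near_jet_and finS param (near_yjet (near_and fx fu))).
by move=> z [[e1 e2] [e3 e4]]; rewrite /= !embY -e3 -e4.
Qed.
End Jets.

(** * Lagrangian control systems *)

Lemma fincoord_state (R : realType) p : fincoord ('rV[R]_p * 'rV[R]_p)%type.
Proof. by apply: fincoord_prod; exact: fincoord_mx. Qed.

(** * Orders in the parameterization for an arbitrary flat output *)

Section SecondOrder.
Context {R : realType} {p m : nat}.
Local Notation config := 'rV[R]_p.
Local Notation state := ('rV[R]_p * 'rV[R]_p)%type.
Local Notation input := 'rV[R]_m.
Context (f : state * input -> config) (xs : state) (us : input).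
Context (sf : smooth_at (xs, us) f) (F0 : sode f (xs, us) = 0).
Local Notation z0 := (const_jet xs us).
Context (l : nat) (phi : @fjet R state m l -> input).
Context (sphi : smooth_at (trunc l z0) phi).
Context (r : 'I_m -> nat) (Fq Fv : 'M[R]_(nrows r, m) -> config)
  (Fu : 'M[R]_(nrows r, m) -> input).
Local Notation N := (nrows r).
Local Notation Fx := (fun y => (Fq y, Fv y)).
Local Notation Y0 := (yjet (sode f) phi N z0).
Context (param : parameterizes (sode f) phi z0 Fx Fu).

Lemma smooth_sode : smooth_at (xs, us) (sode f).
Proof.
apply: smooth_at_pair => //; apply: smooth_at_lin.
exact: (lincont_comp (lincont_fst _ _) (lincont_snd _ _)).
Qed.

Let finS := @fincoord_state R p.
Let sF := smooth_sode.

Lemma param_eq : near_jet z0 (fun z =>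
  z.1 = (Fq (yjet (sode f) phi N z), Fv (yjet (sode f) phi N z)) /\
  z.2 0%N = Fu (yjet (sode f) phi N z)).
Proof. by case: param. Qed.

Lemma param_fx : function_of r 1 Fx. Proof. by case: param. Qed.
Lemma param_fu : function_of r 0 Fu. Proof. by case: param. Qed.

Lemma param_fq : function_of r 1 Fq.
Proof. by move=> Y Y' /param_fx[]. Qed.

Lemma param_fv : function_of r 1 Fv.
Proof. by move=> Y Y' /param_fx[]. Qed.

Lemma param_sx : smooth_at Y0 Fx.
Proof. by case: param => _ /(smooth_nearE _ _ (@fincoord_mx R N m)). Qed.

Lemma param_su : smooth_at Y0 Fu.
Proof. by case: param => _ _ _ /(smooth_nearE _ _ (@fincoord_mx R N m)). Qed.

Lemma param_sq : smooth_at Y0 Fq.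
Proof. exact: smooth_at_comp param_sx (smooth_at_lin _ (lincont_fst _ _)). Qed.

Lemma param_sv : smooth_at Y0 Fv.
Proof. exact: smooth_at_comp param_sx (smooth_at_lin _ (lincont_snd _ _)). Qed.

Lemma param_center : (Fq Y0, Fv Y0) = xs /\ Fu Y0 = us.
Proof. by have [e1 e2] := near_jet_center param_eq; split. Qed.

Lemma param_sf : smooth_at (Fq Y0, Fv Y0, Fu Y0) f.
Proof. by have [-> ->] := param_center. Qed.

Lemma param_dtot : \forall Y \near Y0,
  dtot Fq Y = Fv Y /\ dtot Fv Y = f (Fq Y, Fv Y, Fu Y).
Proof.
have e : \forall Y \near Y0, dtot Fx Y = sode f (Fx Y, Fu Y).
  exact: (dtot_param (F := sode f) (Fx := Fx) finS sF F0 sphi param_fx param_sx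
    param_su param_eq).
apply: filterS3 e (smooth_at_near param_sq) (smooth_at_near param_sv).
move=> Y + /smooth_at_diff dq /smooth_at_diff dv.
by rewrite /dtot derive_pair// => -[].
Qed.

Lemma param_qv : \forall Y \near Y0, dtot Fq Y = Fv Y.
Proof. by apply: filterS param_dtot => Y []. Qed.

Lemma param_vf : \forall Y \near Y0, dtot Fv Y = f (Fq Y, Fv Y, Fu Y).
Proof. by apply: filterS param_dtot => Y []. Qed.

(** Independence of the top order is known only near the equilibrium jet, while [function_of] is
    global; hence Fq is composed with [freeze]. *)
Lemma configuration_order : exists Fq' : 'M[R]_(N, m) -> config,
  [/\ \forall y \near Y0, Fq y = Fq' y,
      smooth_near Y0 Fq',
      [/\ function_of r 2 Fq', function_of r 1 Fv & function_of r 0 Fu] &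
      near_jet z0 (fun z =>
        [/\ z.1.1 = Fq' (yjet (sode f) phi N z), z.1.2 = Fv (yjet (sode f) phi N z) &
            z.2 0%N = Fu (yjet (sode f) phi N z)])].
Proof.
pose good k j := (k + 2 <= r j)%N.
have qE : \forall Y \near Y0, Fq Y = Fq (freeze good Y0 Y).
  apply: freeze_eq param_sq _ => k j; rewrite /good -ltnNge addn2 => rk.
  exact: (indep_q_top (ltn_nrows r) param_fq param_fv param_sq param_qv).
exists (Fq \o freeze good Y0); split=> //.
- apply/(smooth_nearE _ _ (@fincoord_mx R N m)).
  exact: freeze_smooth param_sq.
- split; [|exact: param_fv|exact: param_fu].
  move=> Y Y' YY; congr Fq; apply/matrixP => k j; rewrite !mxE.
  by case: ifP => // kj; exact: YY.
apply: near_jet_imp (near_jet_and finS param_eq (near_yjet finS sF F0 sphi qE)).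
by move=> z [[e1 e2] e3]; rewrite e1 /= -e3.
Qed.
End SecondOrder.

(** * Configuration flat outputs with m = p - 1 *)

Section Configuration.
Context {R : realType} {m : nat}.
Local Notation config := 'rV[R]_m.+1.
Local Notation state := ('rV[R]_m.+1 * 'rV[R]_m.+1)%type.
Local Notation input := 'rV[R]_m.
Context (f : state * input -> config) (xs : state) (us : input).
Context (sf : smooth_at (xs, us) f) (F0 : sode f (xs, us) = 0).
Local Notation z0 := (const_jet xs us).
Context (l : nat) (phi : @fjet R state m l -> input).
Context (sphi : smooth_at (trunc l z0) phi).
Context (r : 'I_m -> nat) (Fq Fv : 'M[R]_(nrows r, m) -> config)
  (Fu : 'M[R]_(nrows r, m) -> input).
Local Notation N := (nrows r).
Local Notation Fx := (fun y => (Fq y, Fv y)).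
Local Notation Y0 := (yjet (sode f) phi N z0).
Context (param : parameterizes (sode f) phi z0 Fx Fu).
Context (h : config -> input).
Context (sh : smooth_at xs.1 h)
  (hsurj : \forall q \near xs.1, forall e, exists d, 'D_d h q = e)
  (phih : \forall z \near trunc l z0, phi z = h z.1.1).

Let finS := @fincoord_state R m.+1.
Let sF := smooth_sode sf.
Let sq := param_sq param.
Let sv := param_sv param.
Let su := param_su param.
Let fq := param_fq param.
Let fv := param_fv param.
Let qv := param_qv sf F0 sphi param.
Let vf := param_vf sf F0 sphi param.
Let sf0 := param_sf sf param.
Let rN := ltn_nrows r.

Lemma q_center : Fq Y0 = xs.1.
Proof. by have [e _] := param_center param; exact: (congr1 fst e). Qed.

Let sh0 : smooth_at (Fq Y0) h. Proof. by rewrite q_center. Qed.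
Let hsurj0 : \forall q \near Fq Y0, forall e, exists d, 'D_d h q = e.
Proof. by rewrite q_center. Qed.

Lemma output_q : \forall Y \near Y0, h (Fq Y) = jrow 0 Y.
Proof.
have [L H] := param_ext (F := sode f) (Fx := Fx) finS (param_eq param).
have [NL _ e] := H _ (leqnn L).
have lL : (l <= L)%N by lia.
have ph : \forall w \near trunc L z0, phi (proj_jet l w) = h (proj_jet l w).1.1.
  apply: (near_preimage (P := fun z => phi z = h z.1.1) ((proj_jet_lincont finS L l).2 _)).
  by rewrite proj_jet_trunc.
apply: filterS (yfin_open (F := sode f) (Fx := Fx) finS sF F0 sphi (param_sx param) su
  (param_eq param) NL (near_and e ph)) => Y [w [[e1 _] e2] <-].
have -> : Fq (yfin (sode f) phi N w) = w.1.1 by rewrite e1.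
rewrite -[w.1.1]/(proj_jet l w).1.1 -e2; apply/rowP => j.
by rewrite (jrow_ord (Ordinal (ltn0Sn _))) mxE.
Qed.

Lemma dphi_config d : dphi (sode f) xs us phi d 0 = 'D_(d.1.1) h xs.1.
Proof.
rewrite /dphi /=; apply: etrans (near_eq_derive (trunc l d) phih) _.
have lp : lincont (fun z : @fjet R state m l => z.1.1).
  exact: (lincont_comp (lincont_fst _ _) (lincont_fst _ _)).
exact: (derive_linl h _ _ lp).
Qed.

Lemma derive_sode d : 'D_d (sode f) (xs, us) = (d.1.2, 'D_d f (xs, us)).
Proof.
have l12 : lincont (fun w : state * input => w.1.2).
  exact: (lincont_comp (lincont_fst _ _) (lincont_snd _ _)).
apply: etrans (derive_pair d (lincont_diff _ l12) (smooth_at_diff sf)) _.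
by rewrite (lincont_derive _ _ l12).
Qed.

(** Perturb the input by w and nothing else. As w lies in the kernel, the linearised flow
    annihilates this jet, and y sees only q; so all dy_[k] vanish, and the linearised
    parameterization returns w = 0. *)
Lemma input_injective w : 'D_(0, 0, w) f (xs, us) = 0 -> w = 0.
Proof.
move=> fw; pose d : jet state m := ((0, 0), fun a => if a is 0 then w else 0).
have Fd : flow_lin (sode f) xs us d = ((0, 0), fun _ => 0).
  apply: (f_equal2 pair) => //; rewrite /= derive_sode.
  by apply: (f_equal2 pair).
have d0 k : dphi (sode f) xs us phi d k = 0.
  case: k => [|k]; first by rewrite dphi_config derive0.
  rewrite (dphi_flow finS sF F0 sphi) Fd /dphi.
  have -> : trunc (k + l) (((0, 0), fun _ => 0) : jet state m) = 0.
    by apply: (f_equal2 pair) => //; apply/matrixP => a j; rewrite !mxE.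
  exact: derive0.
rewrite -[w]/(d.2 0%N) (input_dphi (F := sode f) (Fx := Fx) finS sF F0 sphi
  (param_sx param) su (param_eq param)).
by rewrite big1// => k _; rewrite d0 mul0mx.
Qed.

Lemma near_input_injective :
  \forall Y \near Y0, forall w, 'D_(0, 0, w) f (Fq Y, Fv Y, Fu Y) = 0 -> w = 0.
Proof.
have [e1 e2] := param_center param.
have fin : fincoord (state * input)%type by apply: fincoord_prod => //; exact: fincoord_mx.
have near0 := near_injective fin sf (lincont_inr _ _).1 input_injective.
have sK := smooth_at_pair (smooth_at_pair sq sv) su.
apply: (near_preimage (P := fun z => forall w, 'D_(0, 0, w) f z = 0 -> w = 0)
  (smooth_at_cont sK)).
by rewrite /= e1 e2.
Qed.

(** Perturb q along t in ker dh with v and u unperturbed: y does not change to first order because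
    dh t = 0, nor y_[1] because the velocity perturbation is 0, but q does. *)
Lemma depends_q2 : exists j, ~ indep_of Fq Y0 2 j.
Proof.
have [t t0 ht] := ker_nontrivial (lincont_derive_dir (smooth_at_diff sh)).1.
pose d : jet state m := ((t, 0), fun _ => 0).
have [L H] := param_derive (F := sode f) (Fx := Fx) finS sF F0 sphi (param_sx param) su
  (param_eq param).
have [NL /(_ d)[e _]] := H _ (leqnn L).
set X := 'D_(trunc L d) _ _ in e.
have rwX (k : 'I_N) : jrow k X = dphi (sode f) xs us phi d k.
  rewrite -(row_derive_yfin0 finS sF F0 sphi d k NL); apply/rowP => j.
  by rewrite jrow_ord mxE.
apply: (exists_depends_q rN fq fv sq sv su sf0 qv vf sh0 hsurj0 output_q (X := X)).
- rewrite (rwX (Ordinal (ltn0Sn _))) /= dphi_config; exact: ht.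
- have [N1|N1] := ltnP 1 N; last exact: jrow_out.
  rewrite (rwX (Ordinal N1)) /= (dphi_flow finS sF F0 sphi) dphi_config.
  have -> : (flow_lin (sode f) xs us d).1.1 = 0 by rewrite /= derive_sode.
  by rewrite derive0.
- have -> : 'D_X Fq Y0 = t; last exact: t0.
  have dq := smooth_at_diff sq; have dv := smooth_at_diff sv.
  by have := congr1 fst (etrans e (derive_pair X dq dv)).
Qed.

Let flat3 k j (k2 : (2 < k)%N) : indep_of Fq Y0 k j :=
  indep_q_high rN fq fv sq sv su sf0 qv vf sh0 hsurj0 output_q j k2.

Lemma depends_next j : ~ indep_of Fq Y0 2 j ->
  ~ indep_of Fv Y0 3 j /\ ~ indep_of Fu Y0 4 j.
Proof.
move=> nq.
(* Dependence of q on order 2 forces room for orders 3 and 4, by [indep_q_top] at k = 2. *)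
have r4 : (4 <= r j)%N.
  rewrite leqNgt; apply/negP => r4; apply: nq.
  exact: (indep_q_top rN fq fv sq qv).
have N4 : (4 < N)%N := leq_ltn_trans r4 (rN j).
split; first by apply: (depends_v sq qv _ _ nq); [lia|exact: flat3].
by apply: (depends_u sq sv su sf0 qv vf _ _ _ nq) => //; exact: flat3.
Qed.

(** Orders above 2, 3 and 4 are absent from Fq, Fv and Fu near the equilibrium jet, so no coordinate
    lost in the truncation matters; minimality of r then gives r^j <= 4. *)
Lemma admissible_min4 : admissible (sode f) phi z0 (fun j => minn (r j) 4).
Proof.
have flatv k j : (3 < k)%N -> indep_of Fv Y0 k j.
  case: k => // k k3; have [kN|Nk] := ltnP k.+1 N; last exact: indep_out.
  by apply: (indep_v sq qv kN); apply: flat3; lia.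
have flatu k j : (4 < k)%N -> indep_of Fu Y0 k j.
  case: k => [|[|k]]// k4.
  apply: (indep_u sq sv su sf0 qv vf near_input_injective); apply: flat3; lia.
have bad c (k : 'I_N) j : ~~ (k + c <= minn (r j) 4)%N ->
    (r j < k + c)%N \/ (4 < k + c)%N by lia.
apply: (admissible_shrink (F := sode f) finS sF F0 sphi (Fx := Fx) (Fu := Fu)) => [j|||||].
- exact: geq_minl.
- exact: param_sx param.
- exact: su.
- exact: param_eq param.
- have qE : \forall Y \near Y0, Fq Y =
      Fq (freeze (fun k j => (k + 1 <= minn (r j) 4)%N) Y0 Y).
    apply: freeze_eq sq _ => k j /bad[] kj; last by apply: flat3; lia.
    by apply: near_always => Y; exact: function_of_derive fq kj.
  have vE : \forall Y \near Y0, Fv Y =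
      Fv (freeze (fun k j => (k + 1 <= minn (r j) 4)%N) Y0 Y).
    apply: freeze_eq sv _ => k j /bad[] kj; last by apply: flatv; lia.
    by apply: near_always => Y; exact: function_of_derive fv kj.
  by apply: filterS2 qE vE => Y e1 e2; congr pair.
- apply: freeze_eq su _ => k j /bad[] kj; last by apply: flatu; lia.
  by apply: near_always => Y; exact: function_of_derive (param_fu param) kj.
Qed.

Lemma order_geq2 j : (2 <= r j)%N.
Proof. exact: (order_ge2 rN fq fv sq qv sh0 output_q j (ltn0Sn _)). Qed.
End Configuration.

Unset Implicit Arguments.

Theorem theorem3 (R : realType) (p m l : nat)
    (M : 'rV[R]_p -> 'M[R]_p) (V : 'rV[R]_p -> R) (G : 'rV[R]_p -> 'M[R]_(p, m))
    (f : 'rV[R]_p * 'rV[R]_p * 'rV[R]_m -> 'rV[R]_p)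
    (xs : 'rV[R]_p * 'rV[R]_p) (us : 'rV[R]_m)
    (phi : fjet ('rV[R]_p * 'rV[R]_p)%type m l -> 'rV[R]_m)
    (r : 'I_m -> nat)
    (Fq Fv : 'M[R]_(nrows r, m) -> 'rV[R]_p)
    (Fu : 'M[R]_(nrows r, m) -> 'rV[R]_m) :
  let z0 := const_jet xs us in
  let Y := yjet (sode f) phi (nrows r) in
  lagrangian_control_system M V G f xs us ->
  equilibrium (sode f) xs us ->
  flat_output (sode f) phi z0 ->
  minimal_multi_index (sode f) phi z0 r ->
  parameterizes (sode f) phi z0 (fun y => (Fq y, Fv y)) Fu ->
  (exists Fq' : 'M[R]_(nrows r, m) -> 'rV[R]_p,
     [/\ \forall y \near Y z0, Fq y = Fq' y,
         smooth_near (Y z0) Fq',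
         [/\ function_of r 2 Fq', function_of r 1 Fv & function_of r 0 Fu] &
         near_jet z0 (fun z =>
           [/\ z.1.1 = Fq' (Y z), z.1.2 = Fv (Y z) & z.2 0%N = Fu (Y z)])])
  /\
  (p = m.+1 -> configuration_output phi z0 ->
   [/\ forall j, (2 <= r j <= 4)%N,
       exists j, depends_explicitly Fq (Y z0) j 2 &
       forall j, depends_explicitly Fq (Y z0) j 2 ->
         depends_explicitly Fv (Y z0) j 3 /\ depends_explicitly Fu (Y z0) j 4]).
Proof.
move=> z0 Y [_ _ sf _] F0 [sphi _] [_ rmin] param.
have {}sf : smooth_at (xs, us) f.
  by apply/smooth_nearE => //; apply: fincoord_prod; [exact: fincoord_state|exact: fincoord_mx].
have {}sphi : smooth_at (trunc l z0) phi.
  by apply/smooth_nearE => //; apply: fincoord_prod; [exact: fincoord_state|exact: fincoord_mx].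
split; first exact: (configuration_order (Fq := Fq) (Fv := Fv) sf F0 sphi param).
(* The types of these data involve p, so they are generalised before p is replaced by m + 1. *)
move=> pm; move: M V G f xs us phi Fq Fv sf F0 @z0 @Y sphi rmin param.
rewrite pm => M V G f xs us phi Fq Fv sf F0 z0 Y sphi rmin param [h [sh surj phih]].
have {}sh : smooth_at xs.1 h by apply/smooth_nearE => //; exact: fincoord_mx.
have {}surj : \forall q \near xs.1, forall e, exists d, 'D_d h q = e.
  apply: filterS2 surj (smooth_at_near sh) => q s /smooth_at_diff dq e.
  by have [d <-] := s e; exists d; rewrite deriveE.
split.
- move=> j; rewrite (order_geq2 (Fq := Fq) (Fv := Fv) sf F0 sphi param sh phih) /=.
  have := rmin _ (admissible_min4 (Fq := Fq) (Fv := Fv) sf F0 sphi param sh surj phih) j.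
  by rewrite leq_min => /andP[].
- exact: (depends_q2 (Fq := Fq) (Fv := Fv) sf F0 sphi param sh surj phih).
- exact: (depends_next (Fq := Fq) (Fv := Fv) sf F0 sphi param sh surj phih).
Qed.
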